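(* Let $p\in\mathbb{R}[x]$ be a univariate real polynomial and let $-\infty<a<b<\infty$. (1) The following three conditions are equivalent: $\operatorname{Tr}p$ is convex on $aI\prec X\prec bI$; $p$ is convex on $(a,b)$; $p''(x)[h]$ is cyclically equivalent to a polynomial of the form $$\sum_i q_i^Tq_i+\sum_i r_i^T(x-a)r_i+\sum_i s_i^T(b-x)s_i+\sum_i t_i^T(x-a)(b-x)t_i+\sum_i (x-a)u_i^T(b-x)u_i$$ (all sums finite) for some $q_i,r_i,s_i,t_i,u_i\in\mathbb{R}\langle x,h\rangle$ that are homogeneous of degree one in $h$. (2) The following three conditions are equivalent: $\operatorname{Tr}p$ is convex on $bI\prec X$; $p$ is convex on $(b,\infty)$; $p''(x)[h]$ is cyclically equivalent to a polynomial of the form $$\sum_i q_i^Tq_i+\sum_j r_j^T(x-b)r_j$$ (finite sums) for some $q_i,r_j\in\mathbb{R}\langle x,h\rangle$ homogeneous of degree one in $h$. (3) The following three conditions are equivalent: $\operatorname{Tr}p$ is convex on $X\prec aI$; $p$ is convex on $(-\infty,a)$; $p''(x)[h]$ is cyclically equivalent to a polynomial of the form $$\sum_i q_i^Tq_i+\sum_j r_j^T(a-x)r_j$$ (finite sums) for some $q_i,r_j\in\mathbb{R}\langle x,h\rangle$ homogeneous of degree one in $h$.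
   Context: $\mathbb{S}_n$ denotes the set of real symmetric $n\times n$ matrices; $X\prec Y$ means $Y-X$ is positive definite. $\mathbb{R}\langle x,h\rangle$ is the free associative unital $\mathbb{R}$-algebra on two noncommuting variables $x,h$. It carries the $\mathbb{R}$-linear involution $^T$ that reverses words and fixes $x$ and $h$ (so $(fg)^T=g^Tf^T$). A commutator is an element $fg-gf$ with $f,g\in\mathbb{R}\langle x,h\rangle$. Two polynomials $f,g\in\mathbb{R}\langle x,h\rangle$ are cyclically equivalent if $f-g$ is a (finite) sum of commutators in $\mathbb{R}\langle x,h\rangle$. A polynomial is homogeneous of degree one in $h$ if every word appearing in it contains $h$ exactly once. For a univariate polynomial $p$, the noncommutative second directional derivative (Hessian) is $p''(x)[h]:=\frac{d^2}{dt^2}p(x+th)\big|_{t=0}\in\mathbb{R}\langle x,h\rangle$, where $p(x+th)$ is expanded in $\mathbb{R}\langle x,h\rangle[t]$ with $t$ a commuting variable. ''$\operatorname{Tr}p$ is convex on $aI\prec X\prec bI$'' means that for every $n\in\mathbb{N}$ and all $X,Y\in\mathbb{S}_n$ with $aI\prec X\prec bI$ and $aI\prec Y\prec bI$ one has $\frac12(\operatorname{Tr}p(X)+\operatorname{Tr}p(Y))\ge\operatorname{Tr}p\big(\frac{X+Y}{2}\big)$. The same convention applies to the domains $bI\prec X$ and $X\prec aI$. *)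

(* Defs.v *)
From HB Require Import structures.
From mathcomp Require Import all_boot all_order all_algebra.
From mathcomp Require Import sesquilinear.
From mathcomp Require Import classical_sets reals convex.
From mathcomp Require Import finmap monalg.

Set Implicit Arguments.
Unset Strict Implicit.
Unset Printing Implicit Defensive.

Import Order.TTheory GRing.Theory Num.Theory.
Local Open Scope ring_scope.

(* The free algebra R<x,h> as the monoid algebra of the free monoid on two
   letters: the letter [false] stands for x, the letter [true] for h. *)
Notation ncpoly R := {malg R[{fmonom bool}]}.

Definition nccst (R : realType) (c : R) : ncpoly R := c%:MP.
Definition ncx (R : realType) : ncpoly R := << fmu false >>.
Definition nch (R : realType) : ncpoly R := << fmu true >>.

(* The involution f |-> f^T. *)
Definition ncT (R : realType) (f : ncpoly R) : ncpoly R :=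
  \sum_(w <- msupp f) << f@_w *g FMonom (rev w) >>.

Definition hdeg1 (R : realType) (f : ncpoly R) : bool :=
  all (fun w : {fmonom bool} => count_mem true w == 1%N) (msupp f).

Definition cyc_equiv (R : realType) (f g : ncpoly R) : Prop :=
  exists s : seq (ncpoly R * ncpoly R),
    f - g = \sum_(c <- s) (c.1 * c.2 - c.2 * c.1).

(* p(x + t h) in R<x,h>[t]: here 'X is the central variable t, and [horner]
   over the noncommutative ring R<x,h>[t] is \sum_i p`_i * (x + h t)^i. *)
Definition ncshift (R : realType) (p : {poly R}) : {poly ncpoly R} :=
  (map_poly (fun c : R => (nccst c)%:P) p).[(ncx R)%:P + (nch R)%:P * 'X].

Definition nchess (R : realType) (p : {poly R}) : ncpoly R :=
  ((ncshift p)^`(2)).[0].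

Definition posdefmx (R : realType) (n : nat) (A : 'M[R]_n) : Prop :=
  A \is symmetricmx /\
  forall v : 'cV[R]_n, v != 0 -> 0 < (v^T *m A *m v) 0 0.

Definition mxprec (R : realType) (n : nat) (A B : 'M[R]_n) : Prop :=
  posdefmx (B - A).

(* [D] is a domain of matrices given for every size; sizes are n.+1, so as to
   range over the positive integers. *)
Definition tr_convex_on (R : realType) (p : {poly R})
    (D : forall n : nat, 'M[R]_n.+1 -> Prop) : Prop :=
  forall (n : nat) (X Y : 'M[R]_n.+1),
    X \is symmetricmx -> Y \is symmetricmx -> D n X -> D n Y ->
    2^-1 * (\tr (horner_mx X p) + \tr (horner_mx Y p))
      >= \tr (horner_mx (2^-1 *: (X + Y)) p).

Definition poly_convex_on (R : realType) (p : {poly R}) (i : interval R) : Prop :=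
  @convex_function R R^o [set` i]%classic (fun x : R => p.[x]).

(* Main.v *)
(* If p'' >= 0 on an interval, subtracting its minimum and dividing by a factor
   vanishing where it is attained shows, by induction on the degree, that p'' is
   a combination of squares weighted by affine functions nonnegative on the
   interval; the product (x - a)(b - x) is redundant as a weight, because
   (b - a)(x - a)(b - x) = (x - a)^2 (b - x) + (b - x)^2 (x - a).
   Writing X and Y for the left and right multiplications by x, p''(x)[h] is
   cyclically equivalent to Q(X, Y)(h) h, where
     Q = (p'(X) - p'(Y)) / (X - Y) = int_0^1 p''(Y + s (X - Y)) ds.
   In a term w g^2 of p'', the affine weight becomes s w(X) + (1 - s) w(Y), and
   the integrals of s g^2 and (1 - s) g^2 are sums of squares since their Gram
   matrices of moments are positive semidefinite; this yields the required form.
   Conversely, the trace of such a form is nonnegative on the domain, and it is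
   the second derivative of t |-> Tr p(X + t H).  Finally, 1 x 1 matrices turn
   convexity of Tr p into midpoint convexity of p, whence p'' >= 0. *)
Require Import Defs.
From HB Require Import structures.
From mathcomp Require Import all_boot all_order all_algebra.
From mathcomp Require Import sesquilinear classical_sets reals convex.
From mathcomp Require Import interval_inference polyrcf finmap monalg ring lra.
From mathcomp Require subspace_topology normed_module derive.
Import normed_module.numFieldNormedType.Exports.

Set Implicit Arguments.
Unset Strict Implicit.
Unset Printing Implicit Defensive.

Import Order.TTheory GRing.Theory Num.Theory.
Local Open Scope ring_scope.

(** * Nonnegative polynomials as weighted sums of squares *)

Section RealPolynomials.
Variable R : realType.
Implicit Types (p q r g w : {poly R}) (W : seq {poly R}).

(** By continuity, a negative value at [x] would persist at nearby points of the segment towards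
    [y]. This extends a sign known inside a domain to its boundary points. *)
Lemma horner_ge0_limit q (x y : R) :
  (forall t, 0 < t <= 1 -> 0 <= q.[x + t * (y - x)]) -> 0 <= q.[x].
Proof.
move=> q_ge0; rewrite leNgt; apply/negP => qx_lt0.
pose s := q \Po (x%:P + (y - x)%:P * 'X).
have sE t : s.[t] = q.[x + t * (y - x)].
  by rewrite horner_comp !hornerE mulrC.
have s0 : s.[0] = q.[x] by rewrite sE mul0r addr0.
have [|d d_gt0 sd] := @poly_cont R 0 s (- q.[x]); first by rewrite oppr_gt0.
pose t := Num.min 1 (d / 2).
have t_gt0 : 0 < t by rewrite /t lt_min; apply/andP; split; lra.
have t_le1 : t <= 1 by rewrite /t ge_min lexx.
have t_ltd : t < d.
  by apply: (@le_lt_trans _ _ (d / 2)); [rewrite /t ge_min lexx orbT | lra].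
have := sd t; rewrite subr0 gtr0_norm // => /(_ t_ltd).
rewrite s0 sE ltr_norml => /andP[_].
by have := q_ge0 t; rewrite t_gt0 t_le1 => /(_ isT); lra.
Qed.

(** The mean value theorem is used on both sides of [z], then for the first derivative between the
    two mean points [c1 < c2]; all these points are interior. *)
Lemma deriv2_ge0_convex p (x y l : R) :
  (forall z, x < z < y -> 0 <= p^`(2).[z]) -> x < y -> 0 <= l <= 1 ->
  p.[l * x + (1 - l) * y] <= l * p.[x] + (1 - l) * p.[y].
Proof.
move=> p2 ltxy /andP[l0 l1]; set z := l * x + _.
have [l_eq0|l_neq0] := eqVneq l 0.
  by rewrite /z l_eq0 subr0 !mul0r !mul1r !add0r.
have [l_eq1|l_neq1] := eqVneq l 1.
  by rewrite /z l_eq1 subrr !mul0r !mul1r !addr0.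
have {}l0 : 0 < l by rewrite lt_neqAle eq_sym l_neq0.
have {}l1 : l < 1 by rewrite lt_neqAle l_neq1.
have zx : z - x = (1 - l) * (y - x) by rewrite /z; ring.
have yz : y - z = l * (y - x) by rewrite /z; ring.
have ltxz : x < z by rewrite -subr_gt0 zx mulr_gt0 ?subr_gt0.
have ltzy : z < y by rewrite -subr_gt0 yz mulr_gt0 ?subr_gt0.
have [c1 /[!in_itv]/= /andP[xc1 c1z] e1] := poly_mvt p ltxz.
have [c2 /[!in_itv]/= /andP[zc2 c2y] e2] := poly_mvt p ltzy.
have ltc : c1 < c2 by apply: lt_trans zc2.
have [c3 /[!in_itv]/= /andP[c13 c32] e3] := poly_mvt p^`() ltc.
have p2c3 : 0 <= p^`(2).[c3].
  by apply: p2; rewrite (lt_trans xc1) // (lt_trans c32).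
have le12 : p^`().[c1] <= p^`().[c2].
  rewrite -subr_ge0 e3 mulr_ge0 // ?subr_ge0 ?ltW //.
move: e1 e2; rewrite zx yz => e1 e2.
have : 0 <= l * (1 - l) * (y - x) * (p^`().[c2] - p^`().[c1]).
  by rewrite !mulr_ge0 // ?subr_ge0 // ltW.
(* The right-hand side is the convexity gap at [z]. *)
suff -> : l * (1 - l) * (y - x) * (p^`().[c2] - p^`().[c1]) =
  (1 - l) * (p.[y] - p.[z]) - l * (p.[z] - p.[x]) by lra.
by rewrite e1 e2; ring.
Qed.

(** The symmetric second difference [q] of [p] at [c], as a polynomial in the step [t], starts with
    the second derivative at [c] times [t^2]. Dividing by [t^2] and letting [t] tend to 0 transfers
    its sign. *)
Lemma midconvex_deriv2_ge0 p (c d : R) : 0 < d ->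
  (forall t, 0 < t <= d -> p.[c] *+ 2 <= p.[c + t] + p.[c - t]) ->
  0 <= p^`(2).[c].
Proof.
move=> d_gt0 mid.
pose q := ((p \Po (c%:P + 'X)) + (p \Po (c%:P - 'X))) - (p.[c] *+ 2)%:P.
have qE t : q.[t] = p.[c + t] + p.[c - t] - p.[c] *+ 2.
  by rewrite !hornerE !horner_comp !hornerE.
have q0 : q`_0 = 0 by rewrite -horner_coef0 qE addr0 subr0; ring.
have q1 : q`_1 = 0.
  have -> : q`_1 = q^`().[0] by rewrite horner_coef0 coef_deriv.
  rewrite /q derivB derivC derivD !deriv_comp !derivE subr0 !hornerE.
  by rewrite !horner_comp !hornerE subr0; ring.
have q2 : q`_2 *+ 2 = p^`(2).[c] *+ 2.
  have -> : q`_2 *+ 2 = q^`(2).[0] by rewrite horner_coef0 coef_derivn.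
  rewrite /q !derivSn !derivn0.
  rewrite !(derivB, derivD, derivN, derivC, derivX, deriv_comp, derivM).
  rewrite !(add0r, sub0r, oppr0, subr0, mulr0, addr0, mulr1, mulrN1, opprK).
  by rewrite hornerD !horner_comp !hornerE subr0.
have -> : p^`(2).[c] = (drop_poly 2 q).[0].
  by rewrite horner_coef0 coef_drop_poly; lra.
have qX : q = drop_poly 2 q * 'X^2.
  rewrite -[LHS](poly_take_drop 2) [take_poly 2 q](_ : _ = 0) ?add0r //.
  by apply/polyP => -[|[|i]]; rewrite coef_take_poly coef0.
apply: (@horner_ge0_limit _ 0 d) => t /andP[t0 t1]; rewrite add0r subr0.
have td_gt0 : 0 < t * d by rewrite mulr_gt0.
rewrite -(pmulr_lge0 _ (exprn_gt0 2 td_gt0)).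
have := congr1 (fun s => s.[t * d]) qX; rewrite /= hornerM hornerXn => <-.
by rewrite qE subr_ge0 mid // td_gt0 /= ger_pMl.
Qed.

(** This is the convex cone of sums of squares with weights in [W]. Each square carries exactly one
    weight, and 1 is a weight only when it is listed. *)
Inductive wsos W : {poly R} -> Prop :=
| wsos0 : wsos W 0
| wsosD w g q : w \in W -> wsos W q -> wsos W (w * g ^+ 2 + q).

Lemma wsos_add W q r : wsos W q -> wsos W r -> wsos W (q + r).
Proof.
move=> Wq Wr; elim: Wq => [|w g s Ww _ IH]; first by rewrite add0r.
by rewrite -addrA; apply: wsosD.
Qed.

Lemma wsos_mul_sqr W r q : wsos W q -> wsos W (r ^+ 2 * q).
Proof.
elim=> [|w g s Ww _ IH]; first by rewrite mulr0; apply: wsos0.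
by rewrite mulrDr mulrCA -exprMn; apply: wsosD.
Qed.

Lemma wsos_mem W w : w \in W -> wsos W w.
Proof.
move=> Ww; have := wsosD 1 Ww (wsos0 W).
by rewrite expr1n mulr1 addr0.
Qed.

Lemma wsosZ W (c : R) q : 0 <= c -> wsos W q -> wsos W (c *: q).
Proof.
move=> c_ge0 Wq; rewrite -mul_polyC -(sqr_sqrtr c_ge0) rmorphXn /=.
exact: wsos_mul_sqr.
Qed.

(** Squares commute past [v], so testing the weights is enough. This is how a linear factor is put
    back after a division. *)
Lemma wsos_mulW W v q :
  {in W, forall w, wsos W (v * w)} -> wsos W q -> wsos W (v * q).
Proof.
move=> Wv; elim=> [|w g s Ww _ IH]; first by rewrite mulr0; apply: wsos0.
rewrite mulrDr; apply: wsos_add => //.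
by rewrite mulrA mulrC; apply/wsos_mul_sqr/Wv.
Qed.

Lemma wsos_comp W q r :
  wsos W q -> wsos [seq w \Po r | w <- W] (q \Po r).
Proof.
elim=> [|w g s Ww _ IH]; first by rewrite comp_poly0; apply: wsos0.
rewrite comp_polyD comp_polyM rmorphXn /=; apply: wsosD => //.
exact: map_f.
Qed.

(* Subtract the minimum, then divide by a factor vanishing where it is
   attained. *)
Lemma wsos_min_ind W (D : {pred R}) :
  (forall c, 0 <= c -> wsos W c%:P) ->
  (forall q, {in D, forall x, 0 <= q.[x]} -> (1 < size q)%N ->
     exists2 c, c \in D & {in D, forall x, q.[c] <= q.[x]}) ->
  (forall q c, c \in D -> root q c -> {in D, forall x, 0 <= q.[x]} ->
     exists f q1, [/\ q = f * q1, (1 < size f)%N,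
       {in D, forall x, 0 <= q1.[x]} & forall r, wsos W r -> wsos W (f * r)]) ->
  (exists x, x \in D) ->
  forall q, {in D, forall x, 0 <= q.[x]} -> wsos W q.
Proof.
move=> Wcst Dmin Dfac [x0 Dx0] q; have [n] := ubnP (size q).
elim: n q => // n IH q; rewrite ltnS => le_qn q_ge0.
have [/size1_polyC qC|size_q] := leqP (size q) 1.
  by rewrite qC; apply: Wcst; have := q_ge0 _ Dx0; rewrite {1}qC hornerC.
have [c Dc qc_min] := Dmin q q_ge0 size_q.
have -> : q = (q - q.[c]%:P) + q.[c]%:P by rewrite subrK.
apply: wsos_add; last exact/Wcst/q_ge0.
have [|//|f [q1 [def_q size_f q1_ge0 Wf]]] := Dfac (q - q.[c]%:P) c Dc.
- by rewrite /root !hornerE subrr.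
- by move=> x Dx; rewrite !hornerE subr_ge0; apply: qc_min.
(* The size drops: [f] is not constant, a product of nonzero polynomials has size
   [size f + size q1 - 1], and subtracting a constant keeps the size of the nonconstant [q]. *)
rewrite def_q; apply/Wf/IH => //; apply: leq_trans le_qn.
have [->|q1_neq0] := eqVneq q1 0; first by rewrite size_poly0 (ltn_trans _ size_q).
have size_qc : size (q - q.[c]%:P) = size q.
  by rewrite size_polyDl // size_polyN (leq_ltn_trans (size_polyC_leq1 _)).
rewrite -size_qc def_q size_mul //; last by rewrite -size_poly_gt0 (ltn_trans _ size_f).
by rewrite -subn1 -addnBAC ?(ltnW size_f) // -[X in (X < _)%N]add0n ltn_add2r subn_gt0.
Qed.

(** The cofactor of ['X - c%:P] is nonpositive to the left of [c] and nonnegative to the right, so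
    by continuity it vanishes at [c] too. *)
Lemma root_sqr_factor q (c u v : R) : u < c < v -> root q c ->
  (forall x, u <= x <= v -> 0 <= q.[x]) ->
  exists q1, q = ('X - c%:P) ^+ 2 * q1.
Proof.
move=> /andP[uc cv] /factor_theorem[r def_q] q_ge0.
have rc0 : root r c.
  rewrite /root eq_le; apply/andP; split.
  - rewrite -oppr_ge0 -hornerN; apply: (@horner_ge0_limit _ c u) => t.
    move=> /andP[t0 t1]; have tc : t * (u - c) < 0 by rewrite pmulr_rlt0 ?subr_lt0.
    have := q_ge0 (c + t * (u - c)); rewrite def_q !hornerE [_ + _ - c]addrAC subrr add0r.
    rewrite nmulr_lge0 // oppr_ge0; apply.
    have : (1 - t) * (u - c) <= 0 by rewrite mulr_ge0_le0 ?subr_ge0 // subr_le0 ltW.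
    by lra.
  - apply: (@horner_ge0_limit _ c v) => t.
    move=> /andP[t0 t1]; have tc : 0 < t * (v - c) by rewrite mulr_gt0 ?subr_gt0.
    have := q_ge0 (c + t * (v - c)); rewrite def_q !hornerE [_ + _ - c]addrAC subrr add0r.
    rewrite pmulr_lge0 //; apply.
    have : 0 <= (1 - t) * (v - c) by rewrite mulr_ge0 ?subr_ge0 // ltW.
    by lra.
have [q1 def_r] := factor_theorem _ _ rc0.
by exists q1; rewrite def_q def_r expr2 -mulrA mulrC.
Qed.

Lemma horner_ge0_divisor f q (x y : R) :
  (forall t, 0 < t <= 1 -> 0 < f.[x + t * (y - x)]) ->
  (forall t, 0 < t <= 1 -> 0 <= (f * q).[x + t * (y - x)]) -> 0 <= q.[x].
Proof.
move=> f_gt0 fq_ge0; apply: (@horner_ge0_limit _ x y) => t t01.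
by rewrite -(pmulr_rge0 _ (f_gt0 _ t01)) -hornerM fq_ge0.
Qed.

Lemma horner_min q (u v : R) : u <= v ->
  exists2 c, u <= c <= v & forall x, u <= x <= v -> q.[c] <= q.[x].
Proof.
move=> uv.
have [|c] := @derive.EVT_min R (horner q) u v uv.
  by apply: subspace_topology.continuous_subspaceT; apply: derive.continuous_horner.
by rewrite in_itv /= => cuv c_min; exists c.
Qed.

Lemma itv_ptD_cc (u v x y t : R) : u <= x <= v -> u <= y <= v ->
  0 <= t <= 1 -> u <= x + t * (y - x) <= v.
Proof. by move=> *; apply/andP; split; nra. Qed.

Lemma itv_ptD_oo (u v x y t : R) : u <= x <= v -> u < y < v ->
  0 < t <= 1 -> u < x + t * (y - x) < v.
Proof. by move=> *; apply/andP; split; nra. Qed.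

(* On a segment ending at [x], [f] may vanish only at [x]. *)
Lemma horner_ge0_cofactor f r (D : {pred R}) (c e : R) :
  (forall x y t, x \in D -> y \in D -> 0 <= t <= 1 -> x + t * (y - x) \in D) ->
  e \in D -> e != c -> {in D, forall x, x != c -> 0 < f.[x]} ->
  {in D, forall x, 0 <= (f * r).[x]} -> {in D, forall x, 0 <= r.[x]}.
Proof.
(* Only [c] has to be approached, along the segment towards [e]; elsewhere the segment reduces to
   the point [x]. *)
move=> Dconv De ec f_gt0 fr_ge0 x Dx; pose y := if x == c then e else x.
have Dy : y \in D by rewrite /y; case: ifP.
have xyD t : 0 < t <= 1 -> x + t * (y - x) \in D.
  by move=> /andP[t0 t1]; apply: Dconv => //; rewrite (ltW t0).
have xyc t : 0 < t <= 1 -> x + t * (y - x) != c.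
  move=> /andP[t0 t1]; rewrite /y; case: (eqVneq x c) => [->|xc].
    by rewrite -subr_eq0 addrAC subrr add0r mulf_neq0 ?subr_eq0 // gt_eqF.
  by rewrite subrr mulr0 addr0.
apply: (@horner_ge0_divisor f r x y) => t t01; last by apply: fr_ge0; auto.
by apply: f_gt0; auto.
Qed.

(** The two weights add up to [b - a], so they generate the nonnegative constants; they also
    generate their own product, so the cone is stable under multiplication by either. A minimum at
    an endpoint is divided out by a weight, an interior one by a square. *)
Lemma wsos_itv q (a b : R) : a < b ->
  (forall x, a < x < b -> 0 <= q.[x]) -> wsos [:: 'X - a%:P; b%:P - 'X] q.
Proof.
move=> ltab q_gt0; set W := [:: _; _].
have ba_gt0 : 0 < b - a by rewrite subr_gt0.
have Wa : 'X - a%:P \in W by rewrite mem_head.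
have Wb : b%:P - 'X \in W by rewrite !inE eqxx orbT.
have def1 : 1 = (b - a)^-1 *: (('X - a%:P) + (b%:P - 'X)).
  by rewrite ['X - _ + _]addrC addrA subrK -polyCB -mul_polyC -polyCM mulVf ?gt_eqF.
have Wcst c : 0 <= c -> wsos W c%:P.
  move=> c_ge0; rewrite -[c%:P]mulr1 def1 mul_polyC.
  apply: wsosZ => //; apply: wsosZ; first by rewrite invr_ge0 ltW.
  by apply: wsos_add; apply: wsos_mem.
have Wab : wsos W (('X - a%:P) * (b%:P - 'X)).
  have -> : ('X - a%:P) * (b%:P - 'X) = (b - a)^-1 *: (('X - a%:P) ^+ 2 *
      (b%:P - 'X) + (b%:P - 'X) ^+ 2 * ('X - a%:P)).
    rewrite -[LHS]mul1r [X in X * _ = _]def1 -!scalerAl; congr (_ *: _).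
    by ring.
  apply: wsosZ; first by rewrite invr_ge0 ltW.
  by apply: wsos_add; apply/wsos_mul_sqr/wsos_mem.
have W1 : wsos W 1 by apply: Wcst.
have Wmula r : wsos W r -> wsos W (('X - a%:P) * r).
  apply: wsos_mulW => w; rewrite !inE => /orP[] /eqP-> //.
  by rewrite -expr2 -[_ ^+ 2]mulr1; apply: wsos_mul_sqr.
have Wmulb r : wsos W r -> wsos W ((b%:P - 'X) * r).
  apply: wsos_mulW => w; rewrite !inE => /orP[] /eqP->; first by rewrite mulrC.
  by rewrite -expr2 -[_ ^+ 2]mulr1; apply: wsos_mul_sqr.
(* On the closed interval the minimum is attained; nonnegativity at the endpoints follows by
   continuity. *)
pose D := [pred x | a <= x <= b].
have size_ba : (1 < size (b%:P - 'X)%R)%N.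
  by rewrite -opprB size_polyN size_XsubC.
have Dconv x y t : x \in D -> y \in D -> 0 <= t <= 1 -> x + t * (y - x) \in D.
  by apply: itv_ptD_cc.
have Da : a \in D by rewrite inE lexx ltW.
have Db : b \in D by rewrite inE lexx ltW.
apply: (@wsos_min_ind W D) => //; last 2 first.
- by exists a.
- move=> x Dx; pose m := (a + b) / 2.
  apply: (@horner_ge0_limit _ x m) => t t01; apply: q_gt0.
  by apply: itv_ptD_oo => //; apply/andP; split; rewrite /m; lra.
- move=> r _ _; have [c cD c_min] := horner_min r (ltW ltab).
  by exists c => // x; apply: c_min.
move=> r c Dc rc r_ge0.
have [ca|ca] := eqVneq c a.
  have [r1 def_r] := factor_theorem _ _ rc; rewrite ca mulrC in def_r.
  exists ('X - a%:P), r1; rewrite size_XsubC; split=> //.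
  apply: (@horner_ge0_cofactor ('X - a%:P) _ D a b) => //.
  - by rewrite gt_eqF.
  - by move=> x /andP[ax _] xa; rewrite !hornerE subr_gt0 lt_neqAle eq_sym xa.
  by move=> x Dx; rewrite -def_r; apply: r_ge0.
have [cb|cb] := eqVneq c b.
  have [r1 def_r] := factor_theorem _ _ rc.
  have {}def_r : r = (b%:P - 'X) * - r1.
    by rewrite mulrN -mulNr opprB -cb mulrC.
  exists (b%:P - 'X), (- r1); split=> //.
  apply: (@horner_ge0_cofactor (b%:P - 'X) _ D b a) => //.
  - by rewrite lt_eqF.
  - by move=> x /andP[_ xb] xa; rewrite !hornerE subr_gt0 lt_neqAle xa.
  by move=> x Dx; rewrite -def_r; apply: r_ge0.
have cab : a < c < b.
  by move: Dc; rewrite inE !lt_neqAle => /andP[-> ->]; rewrite eq_sym ca cb.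
have [r1 def_r] := root_sqr_factor cab rc r_ge0.
exists (('X - c%:P) ^+ 2), r1; split=> //.
- by rewrite size_exp_XsubC.
- apply: (@horner_ge0_cofactor (('X - c%:P) ^+ 2) _ D c a) => //.
  + by rewrite eq_sym.
  + by move=> x _ xc; rewrite horner_exp !hornerE exprn_even_gt0 ?subr_eq0.
  by move=> x Dx; rewrite -def_r; apply: r_ge0.
- by move=> s; apply: wsos_mul_sqr.
Qed.

(** Otherwise [- q] would tend to infinity. A positive leading coefficient is what makes the minimum
    on a ray attained. *)
Lemma horner_ge0_lead_coef q (b : R) : (1 < size q)%N ->
  (forall x, b <= x -> 0 <= q.[x]) -> 0 < lead_coef q.
Proof.
move=> size_q q_ge0; rewrite ltNge; apply/negP => lc_le0.
have lc_lt0 : 0 < lead_coef (- q).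
  rewrite lead_coefN oppr_gt0 lt_neqAle lc_le0 lead_coef_eq0 andbT.
  by rewrite -size_poly_gt0 (ltn_trans _ size_q).
have [|n qn] := @poly_lim_infty R (- q) 1 lc_lt0; first by rewrite size_polyN.
have := qn (Num.max n b); rewrite le_max lexx => /(_ isT).
by have := q_ge0 (Num.max n b); rewrite le_max lexx orbT hornerN => /(_ isT); lra.
Qed.

(** Multiples of ['X - b%:P] all vanish at [b], hence the explicit weight 1. The minimum exists
    thanks to the growth at infinity. *)
Lemma wsos_right_ray q (b : R) :
  (forall x, b < x -> 0 <= q.[x]) -> wsos [:: 1; 'X - b%:P] q.
Proof.
move=> q_gt0; set W := [:: _; _].
have W1 : 1 \in W by rewrite mem_head.
have Wb : 'X - b%:P \in W by rewrite !inE eqxx orbT.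
have Wcst c : 0 <= c -> wsos W c%:P.
  move=> c_ge0; rewrite -[c%:P]mulr1 mul_polyC; apply: wsosZ => //.
  exact: wsos_mem.
have Wmulb r : wsos W r -> wsos W (('X - b%:P) * r).
  apply: wsos_mulW => w; rewrite !inE => /orP[] /eqP->.
    by rewrite mulr1; apply: wsos_mem.
  by rewrite -expr2 -[_ ^+ 2]mulr1; apply/wsos_mul_sqr/wsos_mem.
pose D := [pred x | b <= x].
have Dconv x y t : x \in D -> y \in D -> 0 <= t <= 1 -> x + t * (y - x) \in D.
  by rewrite !inE => *; nra.
have Db : b \in D by rewrite inE lexx.
have Db1 : b + 1 \in D by rewrite inE lerDl.
apply: (@wsos_min_ind W D) => //; last 2 first.
- by exists b.
- move=> x; rewrite inE => Dx; apply: (@horner_ge0_limit _ x (x + 1)) => t t01.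
  by apply: q_gt0; rewrite addrAC subrr add0r mulr1; lra.
- move=> r r_ge0 size_r.
  have lc_gt0 := horner_ge0_lead_coef size_r r_ge0.
  have [n rn] := poly_lim_infty r.[b] lc_gt0 size_r.
  (* Beyond [n] the values are at least [r.[b]], so the minimum over this compact interval is the
     minimum over the ray. *)
  have bm : b <= Num.max b n by rewrite le_max lexx.
  have [c /andP[bc cm] c_min] := horner_min r bm.
  exists c => // x; rewrite inE => bx.
  have [nx|xn] := leP n x; last by apply: c_min; rewrite bx le_max (ltW xn) orbT.
  by apply: le_trans (rn _ nx); apply: c_min; rewrite lexx.
move=> r c Dc rc r_ge0.
have [cb|cb] := eqVneq c b.
  have [r1 def_r] := factor_theorem _ _ rc; rewrite cb mulrC in def_r.
  exists ('X - b%:P), r1; rewrite size_XsubC; split=> //.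
  apply: (@horner_ge0_cofactor ('X - b%:P) _ D b (b + 1)) => //.
  - by rewrite gt_eqF // ltrDl.
  - by move=> x; rewrite inE => bx xb; rewrite !hornerE subr_gt0 lt_neqAle eq_sym xb.
  by move=> x Dx; rewrite -def_r; apply: r_ge0.
have cD : b < c < c + 1.
  by move: Dc; rewrite inE ltrDl ltr01 andbT lt_neqAle eq_sym cb.
have [|r1 def_r] := root_sqr_factor cD rc.
  by move=> x /andP[bx _]; apply: r_ge0.
exists (('X - c%:P) ^+ 2), r1; split=> //.
- by rewrite size_exp_XsubC.
- apply: (@horner_ge0_cofactor (('X - c%:P) ^+ 2) _ D c b) => //.
  + by rewrite eq_sym.
  + by move=> x _ xc; rewrite horner_exp !hornerE exprn_even_gt0 ?subr_eq0.
  by move=> x Dx; rewrite -def_r; apply: r_ge0.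
- by move=> s; apply: wsos_mul_sqr.
Qed.

(** The reflection of the line exchanges the two kinds of rays, and [wsos_comp] carries the weights
    back. *)
Lemma wsos_left_ray q (a : R) :
  (forall x, x < a -> 0 <= q.[x]) -> wsos [:: 1; a%:P - 'X] q.
Proof.
move=> q_lt0; pose s := q \Po - 'X.
have : wsos [:: 1; 'X - (- a)%:P] s.
  apply: wsos_right_ray => x xa; rewrite horner_comp !hornerE.
  by apply: q_lt0; rewrite ltrNl.
move/(@wsos_comp _ _ (- 'X)); rewrite /= /s -comp_polyA.
have -> : - 'X \Po - 'X = 'X :> {poly R} by rewrite raddfN /= comp_polyX opprK.
rewrite comp_polyXr comp_polyC comp_polyB comp_polyX comp_polyC.
by rewrite polyCN opprK addrC.
Qed.

End RealPolynomials.

(** * Gram matrices and integration along a segment *)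

Section Gram.
Variable R : rcfType.

Lemma mul_rV_tr_sym n (r v : 'rV[R]_n) : r *m v^T = v *m r^T.
Proof.
apply/matrixP => i j; rewrite !ord1 !mxE.
by apply: eq_bigr => k _; rewrite !mxE mulrC.
Qed.

Lemma qform_block n (m x : R) (r v : 'rV[R]_n) (N : 'M[R]_n) :
  (row_mx x%:M v *m block_mx m%:M r r^T N *m (row_mx x%:M v)^T) 0 0 =
  m * x ^+ 2 + (v *m r^T) 0 0 * x *+ 2 + (v *m N *m v^T) 0 0.
Proof.
rewrite mul_row_block tr_row_mx mul_row_col mulmxDl tr_scalar_mx.
rewrite mulmxDl -!scalar_mxM mul_mx_scalar mul_scalar_mx -scalemxAl.
rewrite (mul_rV_tr_sym r).
move: (v *m r^T) (v *m N *m v^T) => A B.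
by rewrite !mxE eqxx mulr1n; ring.
Qed.

(** A Cholesky factorization by induction on the size: the first row has pivot [m] and remainder
    [r], and the induction hypothesis applies to the Schur complement of [m]. *)
Lemma psd_gram n (M : 'M[R]_n) : M^T = M ->
  (forall v : 'rV_n, 0 <= (v *m M *m v^T) 0 0) -> exists C : 'M_n, M = C^T *m C.
Proof.
elim: n M => [|n IH] M symM psdM.
  by exists 0; rewrite [RHS]flatmx0; apply: flatmx0.
pose m := M 0 0; pose r : 'rV_n := ursubmx (M : 'M_(1 + n)).
pose N : 'M_n := drsubmx (M : 'M_(1 + n)).
have defM : M = block_mx m%:M r r^T N :> 'M_(1 + n).
  rewrite -[LHS](@submxK _ 1 n 1 n); congr block_mx.
    apply/matrixP => i j; rewrite !ord1 !mxE eqxx mulr1n.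
    by rewrite (_ : lshift n 0 = 0) //; apply: val_inj.
  by rewrite /r trmx_ursub; congr dlsubmx; apply/esym/symM.
have qM x (v : 'rV_n) :
    0 <= m * x ^+ 2 + (v *m r^T) 0 0 * x *+ 2 + (v *m N *m v^T) 0 0.
  by rewrite -qform_block -defM.
have m_ge0 : 0 <= m.
  by have := qM 1 0; rewrite !mul0mx !mxE expr1n; lra.
(* With a zero pivot the form is affine in the first coordinate; along a nonzero [r] its slope is
   nonzero, so it would take negative values. *)
have r_eq0 : m = 0 -> r = 0.
  move=> m0; apply/eqP; apply: contraT => r_neq0.
  pose y := (r *m r^T) 0 0; pose z := (r *m N *m r^T) 0 0.
  have y_gt0 : 0 < y.
    rewrite /y mxE lt_neqAle; apply/andP; split.
      apply: contra r_neq0; rewrite eq_sym psumr_eq0 => [/allP r0|j _].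
        apply/eqP/rowP => j; have := r0 j (mem_index_enum _).
        by rewrite !mxE -expr2 sqrf_eq0 => /eqP.
      by rewrite !mxE -expr2 sqr_ge0.
    by apply: sumr_ge0 => j _; rewrite !mxE -expr2 sqr_ge0.
  (* At this first coordinate the form equals -1. *)
  have := qM (- (z + 1) / (y *+ 2)) r; rewrite m0 mul0r add0r -/y -/z.
  have -> : y * (- (z + 1) / (y *+ 2)) *+ 2 = - (z + 1).
    by field; rewrite gt_eqF.
  by lra.
have sm : Num.sqrt m ^+ 2 = m by rewrite sqr_sqrtr.
have [|v|C defC] := IH (N - m^-1 *: (r^T *m r)).
- rewrite linearB linearZ /= trmx_mul trmxK; congr (_ - _).
  by rewrite /N trmx_drsub; congr drsubmx; apply: symM.
- pose y := (v *m r^T) 0 0.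
  have [m0|m_neq0] := eqVneq m 0.
    by have := qM 0 v; rewrite r_eq0 // mulmx0 scaler0 subr0
      expr0n !mulr0 mul0rn !add0r.
  (* This first coordinate minimizes the form, and the minimum is the Schur complement form at
     [v]. *)
  have := qM (- y / m) v; rewrite -/y mulmxBr mulmxBl -scalemxAr -scalemxAl.
  have -> : v *m (r^T *m r) *m v^T = (y * y)%:M.
    rewrite mulmxA -mulmxA (mul_rV_tr_sym r) [v *m r^T]mx11_scalar.
    by rewrite -scalar_mxM.
  move: (v *m N *m v^T) => A; rewrite !mxE eqxx mulr1n.
  suff -> : m * (- y / m) ^+ 2 + y * (- y / m) *+ 2 + A 0 0 =
     A 0 0 - m^-1 * (y * y) by [].
  by field.
(* If [m = 0] the inverse of its root is 0 by convention, and [r] vanishes. *)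
pose B : 'M_(1 + n) := block_mx (Num.sqrt m)%:M ((Num.sqrt m)^-1 *: r) 0 C.
exists B; apply: (etrans defM); rewrite [RHS](_ : _ = B^T *m B) //.
rewrite tr_block_mx mulmx_block; congr block_mx.
- by rewrite trmx0 mul0mx addr0 tr_scalar_mx -scalar_mxM -expr2 sm.
- rewrite trmx0 mul0mx addr0 tr_scalar_mx mul_scalar_mx scalerA.
  have [m0|m_neq0] := eqVneq m 0; first by rewrite r_eq0 // scaler0.
  by rewrite divff ?scale1r // sqrtr_eq0 -ltNge lt_neqAle eq_sym m_neq0.
- rewrite mulmx0 addr0 linearZ /= -scalemxAl mul_mx_scalar scalerA.
  have [m0|m_neq0] := eqVneq m 0; first by rewrite r_eq0 // trmx0 scaler0.
  by rewrite mulVf ?scale1r // sqrtr_eq0 -ltNge lt_neqAle eq_sym m_neq0.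
- rewrite -defC [(_ *: r)^T]linearZ /= -scalemxAl -scalemxAr scalerA -expr2 exprVn sm.
  by rewrite addrC subrK.
Qed.

End Gram.

(** * Formal integrals over the unit segment *)

Section SegmentIntegral.
Variables (R : realType) (K : comNzRingType) (iota : {rmorphism R -> K}).
Implicit Types (f g G : {poly K}).

(* The formal integral over [0, 1]. *)
Definition segint f : K := \sum_(k < size f) iota k.+1%:R^-1 * f`_k.

Lemma segintE n f : (size f <= n)%N ->
  segint f = \sum_(k < n) iota k.+1%:R^-1 * f`_k.
Proof.
move=> le_fn; rewrite /segint.
rewrite -!(big_mkord xpredT (fun k => iota k.+1%:R^-1 * f`_k)).
rewrite [RHS](big_cat_nat _ le_fn) //= [X in _ = _ + X]big1_seq ?addr0 //.
by move=> k /andP[_]; rewrite mem_index_iota => /andP[fk _]; rewrite nth_default ?mulr0.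
Qed.

Lemma segint_linear : linear_for *%R segint.
Proof.
move=> c f g; pose n := maxn (size (c *: f + g)) (maxn (size f) (size g)).
rewrite !(@segintE n) ?leq_max ?leqnn ?orbT //.
rewrite mulr_sumr -big_split; apply: eq_bigr => k _ /=.
by rewrite coefD coefZ mulrDr mulrCA.
Qed.

HB.instance Definition _ :=
  GRing.isLinear.Build K {poly K} K *%R segint segint_linear.

Lemma segint_deriv f : segint f^`() = f.[1] - f.[0].
Proof.
rewrite (@segintE (size f)) ?(leq_trans (size_poly _ _)) ?leq_pred //.
rewrite horner_coef0 (@horner_coef_wide _ (size f).+1) // big_ord_recl.
rewrite /= expr0 mulr1 addrAC subrr add0r; apply: eq_bigr => k _.
rewrite expr1n mulr1 coef_deriv /= -[X in _ * X]mulr_natr mulrCA.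
by rewrite -(rmorph_nat iota) -rmorphM mulVf ?pnatr_eq0 // rmorph1 mulr1.
Qed.

(** Expanding the square exhibits the quadratic form of the moment matrix of [w]. Over [R] this
    shows that the matrix is semidefinite; over [K] it gives the decomposition into squares. *)
Lemma segint_mul_sqr w n (c : 'I_n -> K) :
  segint (w * (\sum_i c i *: 'X^i) ^+ 2) =
  \sum_i \sum_j c i * c j * segint (w * 'X^(i + j)).
Proof.
rewrite expr2 mulr_suml mulr_sumr linear_sum; apply: eq_bigr => i _.
rewrite !mulr_sumr linear_sum; apply: eq_bigr => j _.
by rewrite -scalerAl -!scalerAr scalerA -exprD linearZ.
Qed.

End SegmentIntegral.

Section SegmentIntegralSOS.
Variable R : realType.
Local Notation segR := (segint (idfun : {rmorphism R -> R})).

(** The mean value theorem for the antiderivative [F] makes the integral a value of [f]. *)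
Lemma segint_ge0 (f : {poly R}) :
  (forall t, 0 <= t <= 1 -> 0 <= f.[t]) -> 0 <= segR f.
Proof.
move=> f_ge0; pose F := \poly_(k < (size f).+1) (k%:R^-1 * f`_k.-1).
have defF : F^`() = f.
  apply/polyP => k; rewrite coef_deriv coef_poly ltnS.
  have [fk|kf] := ltnP k (size f); last by rewrite mul0rn nth_default.
  by rewrite -[LHS]mulr_natl mulVKf ?pnatr_eq0.
rewrite -defF segint_deriv; have [c] := poly_mvt F (@ltr01 R).
rewrite in_itv /= => /andP[c0 c1] ->.
by rewrite subr0 mulr1 defF f_ge0 // !ltW.
Qed.

Variables (K : comNzRingType) (iota : {rmorphism R -> K}).

Lemma segint_map (f : {poly R}) : segint iota (map_poly iota f) = iota (segR f).
Proof.
rewrite /segint size_map_poly rmorph_sum; apply: eq_bigr => k _.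
by rewrite rmorphM coef_map.
Qed.

(** The moment matrix [M] of [w] is real and semidefinite, so it is [C^T *m C]. The integral is the
    form of [M] at the coefficients of [G], and each row of [C] contributes one square in [K]. *)
Lemma segint_sos (w : {poly R}) (G : {poly K}) :
  (forall t, 0 <= t <= 1 -> 0 <= w.[t]) ->
  exists s : seq K, segint iota (map_poly iota w * G ^+ 2) = \sum_(u <- s) u ^+ 2.
Proof.
move=> w_ge0; pose n := size G.
pose M := \matrix_(i < n, j < n) segR (w * 'X^(i + j)).
have [||C defM] := @psd_gram R n M.
- by apply/matrixP => i j; rewrite !mxE addnC.
- move=> v; have -> : (v *m M *m v^T) 0 0 = segR (w * (\sum_i v 0 i *: 'X^i) ^+ 2).
    rewrite segint_mul_sqr mxE exchange_big; apply: eq_bigr => j _ /=.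
    rewrite !mxE mulr_suml; apply: eq_bigr => i _.
    by rewrite !mxE [in RHS]mulrAC.
  apply: segint_ge0 => t t01; rewrite hornerM horner_exp mulr_ge0 ?sqr_ge0 //.
  exact: w_ge0.
exists [seq \sum_i iota (C k i) * G`_i | k : 'I_n].
have -> : G ^+ 2 = (\sum_(i < n) G`_i *: 'X^i) ^+ 2 by rewrite -poly_def coefK.
rewrite segint_mul_sqr big_map big_enum /=.
under [RHS]eq_bigr do rewrite expr2 mulr_suml.
rewrite [RHS]exchange_big; apply: eq_bigr => i _ /=.
under [RHS]eq_bigr do rewrite mulr_sumr.
rewrite [RHS]exchange_big; apply: eq_bigr => j _ /=.
rewrite -(map_polyXn iota) -rmorphM /= segint_map.
have -> : segR (w * 'X^(i + j)) = M i j by rewrite mxE.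
rewrite defM mxE rmorph_sum mulr_sumr; apply: eq_bigr => k _.
by rewrite mxE rmorphM /=; ring.
Qed.

End SegmentIntegralSOS.

Section SegmentPath.
Variables (R : realType) (K : comNzRingType) (iota : {rmorphism R -> K}) (X Y : K).
Local Notation "p ^i" := (map_poly iota p) (at level 2, format "p ^i").
Local Notation Z := (Y%:P + (X - Y)%:P * 'X).

(** The fundamental theorem of calculus on the path from [Y] to [X]. It identifies the integral of
    the derivative with the divided difference of [p]. *)
Lemma segint_path_deriv (p : {poly R}) :
  (X - Y) * segint iota (p^`()^i \Po Z) = p^i.[X] - p^i.[Y].
Proof.
have -> : p^i.[X] - p^i.[Y] = (p^i \Po Z).[1] - (p^i \Po Z).[0].
  rewrite !horner_comp !hornerE /=; congr (_.[_] - _.[_]).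
  by rewrite addrAC subrr add0r.
rewrite -(segint_deriv iota) deriv_comp -deriv_map derivD derivC add0r.
rewrite derivM derivC mul0r add0r derivX mulr1 [in RHS]mulrC.
by rewrite [_%:P * (_ \Po _)]mul_polyC linearZ.
Qed.

Lemma affine_comp_path (w : {poly R}) : (size w <= 2)%N ->
  w^i \Po Z = w^i.[X] *: 'X + w^i.[Y] *: (1 - 'X).
Proof.
move=> size_w; have -> : w^i = w^i`_1 *: 'X + (w^i`_0)%:P.
  apply/polyP => -[|[|i]]; rewrite coefD coefZ coefX coefC ?mulr0 ?mulr1 ?add0r ?addr0 //.
  by rewrite nth_default // (leq_trans (size_poly _ _)) // (leq_trans size_w).
rewrite comp_polyD comp_polyZ comp_polyX comp_polyC !hornerE -!mul_polyC.
by rewrite !(polyCD, polyCM, polyCN); ring.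
Qed.

(** An affine weight interpolates along the path between its values at [X] and [Y], with factors
    ['X] and [1 - 'X]. Both are nonnegative on the unit segment, so [segint_sos] applies to each;
    [s] collects the squares weighted at [X], and [t] those weighted at [Y]. *)
Lemma segint_wsos (W : seq {poly R}) (f : {poly R}) :
  {in W, forall w : {poly R}, (size w <= 2)%N} -> wsos W f ->
  exists s t : seq ({poly R} * K), all (fun c => c.1 \in W) (s ++ t) /\
    segint iota (f^i \Po Z) = \sum_(c <- s) c.1^i.[X] * c.2 ^+ 2 +
                              \sum_(c <- t) c.1^i.[Y] * c.2 ^+ 2.
Proof.
move=> sizeW; elim=> [|w g q Ww _ [s [t [Wst IH]]]].
  by exists [::], [::]; rewrite !big_nil rmorph0 comp_poly0 raddf0 addr0.
have [|u defu] := @segint_sos R K iota 'X (g^i \Po Z).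
  by move=> x /andP[]; rewrite hornerX.
have [|v defv] := @segint_sos R K iota (1 - 'X) (g^i \Po Z).
  by move=> x /andP[_]; rewrite !hornerE subr_ge0.
exists ([seq (w, a) | a <- u] ++ s), ([seq (w, a) | a <- v] ++ t); split.
  move: Wst; rewrite !all_cat !all_map => /andP[-> ->]; rewrite !andbT.
  by apply/andP; split; apply/allP.
rewrite !big_cat !big_map /= -!mulr_sumr -defu -defv.
have -> : (w * g ^+ 2 + q)^i = w^i * g^i ^+ 2 + q^i.
  by rewrite rmorphD rmorphM rmorphXn.
rewrite comp_polyD comp_polyM expr2 comp_polyM -expr2.
rewrite (@affine_comp_path w) ?sizeW // mulrDl !(linearD (segint iota)) /= IH.
have -> : (1 - 'X)^i = 1 - 'X by rewrite rmorphB rmorph1 /= map_polyX.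
rewrite -!scalerAl !linearZ /= map_polyX.
by rewrite addrACA.
Qed.

End SegmentPath.

(** * Cyclic equivalence and the Hessian *)

Section CyclicEquivalence.
Variable A : nzRingType.
Implicit Types f g : A.

(** Over a general ring, this notion also applies to polynomials in [t] over the free algebra; over
    [ncpoly R] it is [cyc_equiv]. *)
Definition cyceq f g :=
  exists s : seq (A * A), f - g = \sum_(c <- s) (c.1 * c.2 - c.2 * c.1).

Lemma cyceq_refl f : cyceq f f.
Proof. by exists [::]; rewrite big_nil subrr. Qed.

Lemma cyceq_trans g f k : cyceq f g -> cyceq g k -> cyceq f k.
Proof.
move=> [s fg] [t gk]; exists (s ++ t).
by rewrite big_cat /= -fg -gk addrA subrK.
Qed.

Lemma cyceqD f g f' g' : cyceq f g -> cyceq f' g' -> cyceq (f + f') (g + g').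
Proof.
move=> [s fg] [t fg']; exists (s ++ t).
by rewrite big_cat /= -fg -fg' opprD addrACA.
Qed.

Lemma cyceq_sum (I : Type) (r : seq I) (F G : I -> A) :
  (forall i, cyceq (F i) (G i)) -> cyceq (\sum_(i <- r) F i) (\sum_(i <- r) G i).
Proof.
move=> FG; elim/big_ind2: _ => [|f f' g g'|i _]; [exact: cyceq_refl| |exact: FG].
exact: cyceqD.
Qed.

Lemma cyceq_mulC f g : cyceq (f * g) (g * f).
Proof. by exists [:: (f, g)]; rewrite big_seq1. Qed.

Lemma cyceq_sym f g : cyceq f g -> cyceq g f.
Proof.
move=> [s fg]; exists [seq (c.2, c.1) | c <- s]; rewrite big_map /=.
by rewrite -opprB fg -sumrN; apply: eq_bigr => c _; rewrite opprB.
Qed.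

Lemma cyceq_central c f g : (forall a, c * a = a * c) ->
  cyceq f g -> cyceq (c * f) (c * g).
Proof.
move=> cC [s fg]; exists [seq (c * d.1, d.2) | d <- s]; rewrite big_map /=.
rewrite -mulrBr fg mulr_sumr; apply: eq_bigr => d _.
by rewrite mulrBr !mulrA -(cC d.2).
Qed.

End CyclicEquivalence.

Section PolynomialCyclicEquivalence.
Variable A : nzRingType.

(** The variable is central, so each coefficient of a commutator is a sum of commutators of
    coefficients, with indices adding up to [k]. *)
Lemma cyceq_coef k (f g : {poly A}) : cyceq f g -> cyceq f`_k g`_k.
Proof.
move=> [s fg]; pose F (c : {poly A} * {poly A}) i := (c.1`_i, c.2`_(k - i)).
exists [seq F c i | c <- s, i <- index_iota 0 k.+1].
rewrite -coefB fg coef_sum big_allpairs_dep; apply: eq_bigr => c _ /=.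
rewrite coefB coefM coefMr -sumrB.
by rewrite -(big_mkord xpredT (fun i => c.1`_i * c.2`_(k - i) - c.2`_(k - i) * c.1`_i)).
Qed.

(** By the Leibniz rule the derivative is a sum of products of powers of [z] around one derivative
    of [z], and rotation makes them all equal. The prefix [z ^+ m] holds the factors already passed
    in the induction. *)
Lemma cyceq_deriv_exp (z : {poly A}) m n :
  cyceq (z ^+ m * (z ^+ n)^`()) ((z ^+ (m + n).-1 * z^`()) *+ n).
Proof.
elim: n m => [|n IH] m; first by rewrite expr0 derivC mulr0; apply: cyceq_refl.
rewrite exprS derivM mulrDr mulrA mulrA -exprSr addnS mulrS /=.
apply: cyceqD; last by apply: cyceq_trans (IH _) _; rewrite addSn; apply: cyceq_refl.
by apply: cyceq_trans (cyceq_mulC _ _) _; rewrite mulrA -exprD addnC; apply: cyceq_refl.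
Qed.

End PolynomialCyclicEquivalence.

(** * The Hessian as a two-sided action of polynomials on [h] *)

Section Hessian.
Variables (R : realType) (A : nzRingType) (cst : {rmorphism R -> A}).
Hypothesis cstC : forall c a, cst c * a = a * cst c.
Variables x h : A.
Local Notation z := (x%:P + h%:P * 'X).
Local Notation cstP := (polyC \o cst).
Local Notation "p ^z" := ((map_poly cstP p).[z]) (at level 2, format "p ^z").

Lemma deriv_line : z^`() = h%:P.
Proof. by rewrite derivD derivM !derivC derivX mul0r !add0r mulr1. Qed.

Lemma cstPC c (a : {poly A}) : cstP c * a = a * cstP c.
Proof. by apply/polyP => i; rewrite /= coefCM coefMC cstC. Qed.

Lemma cyceq_deriv_horner (p : {poly R}) : cyceq (p^z)^`() (p^`()^z * h%:P).
Proof.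
pose n := size p.
have le_map (q : {poly R}) : (size (map_poly cstP q) <= size q)%N.
  exact: size_poly.
rewrite (@horner_coef_wide _ n.+1) ?(leq_trans (le_map _)) //.
rewrite (@horner_coef_wide _ n) ?(leq_trans (le_map _)) ?(leq_trans (size_poly _ _)) ?leq_pred //.
rewrite raddf_sum mulr_suml big_ord_recl /= derivM expr0 derivC mulr0 addr0.
rewrite coef_map derivC mul0r add0r; apply: cyceq_sum => i.
rewrite coef_map derivM derivC mul0r add0r coef_map coef_deriv.
rewrite raddfMn /bump leq0n add1n !mulrnAl -mulrA -mulrnAr /=.
apply: cyceq_central => [a|]; first exact: cstPC.
have := cyceq_deriv_exp z 0 i.+1; rewrite expr0 mul1r deriv_line.
by [].
Qed.

Lemma cst_comm : commr_rmorph cst x.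
Proof. by move=> c; apply/esym/cstC. Qed.

Local Notation ev := (horner_morph cst_comm).

Lemma evC (p q : {poly R}) : ev p * ev q = ev q * ev p.
Proof. by rewrite -!rmorphM mulrC. Qed.

Lemma ev_X : ev 'X = x. Proof. exact: horner_morphX. Qed.

Lemma ev_cst c : ev c%:P = cst c.
Proof. by rewrite /horner_morph map_polyC hornerC. Qed.

Lemma ev_1 : ev 1 = 1. Proof. exact: rmorph1. Qed.

Lemma ev_XsubC c : ev ('X - c%:P) = x - cst c.
Proof. by rewrite rmorphB /= ev_X ev_cst. Qed.

Lemma ev_CsubX c : ev (c%:P - 'X) = cst c - x.
Proof. by rewrite rmorphB /= ev_X ev_cst. Qed.

Lemma evE (p : {poly R}) : ev p = \sum_(i < size p) cst p`_i * x ^+ i.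
Proof.
rewrite /horner_morph (@horner_coef_wide _ (size p)) ?size_poly //.
by apply: eq_bigr => i _; rewrite coef_map.
Qed.

Local Notation K := {poly {poly R}}.
Local Notation kst := (polyC \o polyC : R -> K).

Definition evh (c : {poly R}) : A := ev c * h.

(* [biact] sends [X^i Y^j] to [x^i h x^j], where the inner variable of [K] is [X]
   and the outer one is [Y]; [biactT] sends it to [x^j h x^i]. *)
Definition biact (P : K) : A := (map_poly evh P).[x].

Definition biactT (P : K) : A := \sum_(j < size P) x ^+ j * (h * ev P`_j).

Fact evh_additive : additive evh.
Proof. by move=> c d; rewrite /evh rmorphB mulrBl. Qed.

HB.instance Definition _ := GRing.isAdditive.Build {poly R} A evh evh_additive.

Fact biact_additive : additive biact.
Proof. by move=> P Q; rewrite /biact raddfB hornerD hornerN. Qed.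

HB.instance Definition _ := GRing.isAdditive.Build K A biact biact_additive.

Lemma biact_mulY P : biact (P * 'X) = biact P * x.
Proof.
rewrite /biact -hornerMX; congr (_.[_]); apply/polyP => i.
by rewrite coefMX !coef_map coefMX; case: i => //=; rewrite raddf0.
Qed.

Lemma biact_mulC c P : biact (c%:P * P) = ev c * biact P.
Proof.
rewrite /biact -hornerCM; congr (_.[_]); apply/polyP => i.
by rewrite coefCM !coef_map /= /evh coefCM rmorphM mulrA.
Qed.

Lemma biactC c : biact c%:P = ev c * h.
Proof. by rewrite /biact map_polyC hornerC. Qed.

Lemma biact_mulXn P n : biact (P * 'X^n) = biact P * x ^+ n.
Proof.
elim: n => [|n IH]; first by rewrite !expr0 !mulr1.
by rewrite !exprSr mulrA biact_mulY IH mulrA.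
Qed.

Lemma biactE P : biact P = \sum_(j < size P) ev P`_j * h * x ^+ j.
Proof.
rewrite -[in LHS](coefK P) poly_def raddf_sum; apply: eq_bigr => j _.
by rewrite -mul_polyC /= biact_mulXn biactC.
Qed.

Lemma biact_mulYpoly P (w : {poly R}) :
  biact (P * map_poly polyC w) = biact P * ev w.
Proof.
rewrite -(coefK w) poly_def !rmorph_sum !mulr_sumr raddf_sum.
apply: eq_bigr => j _; rewrite -mul_polyC !rmorphM !rmorphXn /= map_polyX ev_X.
rewrite map_polyC mulrCA biact_mulC biact_mulXn /=.
have -> : ev (w`_j)%:P = cst w`_j by rewrite /horner_morph map_polyC hornerC.
by rewrite cstC [cst _ * _]cstC mulrA.
Qed.

Lemma sqr_poly_def (U : K) :
  U ^+ 2 = \sum_(i < size U) \sum_(j < size U) (U`_i * U`_j)%:P * 'X^(i + j).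
Proof.
rewrite -{1}(coefK U) poly_def expr2 mulr_suml; apply: eq_bigr => i _.
rewrite mulr_sumr; apply: eq_bigr => j _.
by rewrite -!mul_polyC polyCM exprD; ring.
Qed.

(** The terms on the right are [x^i h U_i w U_j h x^j]. Rotating the prefix [x^i h] to the end gives
    [U_i w U_j h x^(i+j) h], where [w] acts to the left of the first [h]. *)
Lemma biact_sqr_X U (w : {poly R}) :
  cyceq (biact (w%:P * U ^+ 2) * h) (biactT U * ev w * biact U).
Proof.
rewrite sqr_poly_def mulr_sumr raddf_sum mulr_suml biactE !mulr_suml.
apply: cyceq_sum => i; rewrite mulr_sumr raddf_sum mulr_suml mulr_sumr.
apply: cyceq_sum => j; rewrite [w%:P * _]mulrA -polyCM /= biact_mulXn biactC; apply: cyceq_sym.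
apply: (@cyceq_trans _ ((x ^+ i * h) * (ev U`_i * ev w * (ev U`_j * h * x ^+ j)))).
  by rewrite !mulrA; apply: cyceq_refl.
apply: cyceq_trans (cyceq_mulC _ _) _.
rewrite [_ * ev w]evC [(i + j)%N]addnC exprD !rmorphM !mulrA.
exact: cyceq_refl.
Qed.

(** The terms on the right are [U_i h x^i w x^j h U_j]. Rotating the last factor to the front leaves
    [w] between the two letters [h], that is, acting through the second variable. *)
Lemma biact_sqr_Y U (w : {poly R}) :
  cyceq (biact (map_poly polyC w * U ^+ 2) * h) (biact U * ev w * biactT U).
Proof.
rewrite sqr_poly_def mulr_sumr raddf_sum mulr_suml biactE !mulr_suml.
apply: cyceq_sum => i; rewrite mulr_sumr raddf_sum mulr_suml mulr_sumr.
apply: cyceq_sum => j; rewrite mulrC /= biact_mulYpoly biact_mulXn biactC.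
apply: cyceq_sym.
apply: (@cyceq_trans _ ((ev U`_i * h * x ^+ i * ev w * x ^+ j * h) * ev U`_j)).
  by rewrite !mulrA; apply: cyceq_refl.
apply: cyceq_trans (cyceq_mulC _ _) _.
have -> : x ^+ j = ev 'X^j by rewrite rmorphXn /= ev_X.
have -> : x ^+ (i + j) = ev 'X^(i + j) by rewrite rmorphXn /= ev_X.
have -> : x ^+ i = ev 'X^i by rewrite rmorphXn /= ev_X.
rewrite exprD !rmorphM !mulrA [ev U`_i * _]evC.
rewrite -[_ * ev w * ev 'X^j]mulrA [ev w * _]evC !mulrA; apply: cyceq_refl.
Qed.

Lemma horner_line_rec (p : {poly R}) (c : R) :
  (p * 'X + c%:P)^z = p^z * x%:P + p^z * h%:P * 'X + (cst c)%:P.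
Proof.
have cz : commr_rmorph cstP z by move=> d; apply/esym/cstPC.
rewrite -[LHS]/(horner_morph cz _) rmorphD rmorphM /= horner_morphX.
by rewrite /horner_morph map_polyC hornerC mulrDr -mulrA.
Qed.

Lemma coef0_horner_line (p : {poly R}) : (p^z)`_0 = ev p.
Proof.
elim/poly_ind: p => [|p c IH]; first by rewrite !raddf0 horner0 coef0.
rewrite horner_line_rec rmorphD rmorphM /= !coefD coefMX coefMC coefC /=.
by rewrite IH addr0 ev_X /horner_morph map_polyC hornerC.
Qed.

(** The divided difference and the linear coefficient along the line obey the same recursion:
    passing from [p] to [p * 'X + c%:P] multiplies by the right variable and adds [p] in the left
    one. *)
Lemma biact_diff_quotient (p : {poly R}) :
  exists2 D : K, ('X%:P - 'X) * D = p%:P - map_poly polyC p &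
    biact D = (p^z)`_1.
Proof.
elim/poly_ind: p => [|p c [D defD hD]].
  exists 0; first by rewrite mulr0 map_poly0 polyC0 subr0.
  by rewrite raddf0 map_poly0 horner0 coef0.
exists (D * 'X + p%:P).
  rewrite mulrDr mulrA defD polyCD polyCM rmorphD rmorphM /= map_polyX map_polyC /=.
  by ring.
rewrite raddfD /= biact_mulY biactC hD horner_line_rec !coefD coefMX !coefMC.
by rewrite coefC /= coef0_horner_line addr0.
Qed.

(** The divided difference is unique, because [K] is a domain in which the two variables differ. *)
Lemma biact_coef1 (p : {poly R}) (D : K) :
  ('X%:P - 'X) * D = p%:P - map_poly polyC p -> biact D = (p^z)`_1.
Proof.
have [D0 defD0 <-] := biact_diff_quotient p; rewrite -defD0 => /mulfI-> //.
rewrite subr_eq0; apply/eqP => /(congr1 (fun P : K => P`_1)).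
by rewrite coefC coefX /= => /eqP; rewrite eq_sym oner_eq0.
Qed.

Lemma hess_cyceq (W : seq {poly R}) (p : {poly R}) :
  {in W, forall w : {poly R}, (size w <= 2)%N} -> wsos W p^`(2) ->
  exists s t : seq ({poly R} * K), all (fun c => c.1 \in W) (s ++ t) /\
    cyceq ((p^z)^`(2)).[0]
      (\sum_(c <- s) biactT c.2 * ev c.1 * biact c.2 +
       \sum_(c <- t) biact c.2 * ev c.1 * biactT c.2).
Proof.
move=> sizeW Wp.
have [s [t [Wst defI]]] := @segint_wsos R K kst 'X%:P 'X W _ sizeW Wp.
exists s, t; split=> //.
(* The second derivative at 0 is the linear coefficient of the first derivative, for which the chain
   rule holds up to commutators. *)
apply: (@cyceq_trans _ ((p^`()^z)`_1 * h)).
  rewrite horner_coef0 derivnS coef_deriv mulr1n derivn1.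
  by rewrite -coefMC; apply/cyceq_coef/cyceq_deriv_horner.
have eX q : (map_poly kst q).['X%:P] = q%:P.
  by rewrite map_poly_comp horner_map /= -[X in _ = X%:P]comp_polyXr.
have eY q : (map_poly kst q).['X] = map_poly polyC q.
  by rewrite map_poly_comp; apply: comp_polyXr.
(* The divided difference of the first derivative is the segment integral of the second. *)
rewrite -(@biact_coef1 _ (segint kst (map_poly kst p^`(2) \Po ('X%:P + ('X%:P - 'X)%:P * 'X)))); last first.
  by rewrite segint_path_deriv eX eY.
rewrite defI raddfD mulrDl /=; apply: cyceqD.
  rewrite raddf_sum mulr_suml; apply: cyceq_sum => c; rewrite eX.
  exact: biact_sqr_X.
rewrite raddf_sum mulr_suml; apply: cyceq_sum => c; rewrite eY.
exact: biact_sqr_Y.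
Qed.

End Hessian.

(** * The free algebra *)

(** This sorts weighted terms by weight. If [x = y], all of them go to the first sum. *)
Lemma big_two_values (T : eqType) (U : Type) (V : nmodType) (F : T -> U -> V)
    (x y : T) (s : seq (T * U)) : all (fun c => c.1 \in [:: x; y]) s ->
  \sum_(c <- s) F c.1 c.2 = \sum_(u <- [seq c.2 | c <- s & c.1 == x]) F x u +
                            \sum_(u <- [seq c.2 | c <- s & c.1 != x]) F y u.
Proof.
rewrite !big_map !big_filter; elim: s => [|[v u] s IH] /=.
  by rewrite !big_nil addr0.
rewrite !big_cons /= !inE => /andP[/orP[]/eqP-> /IH->]; first by rewrite eqxx addrA.
case: (eqVneq y x) => [->|_] /=; first by rewrite addrA.
by rewrite addrCA.
Qed.

Section FreeAlgebra.
Variable R : realType.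
Implicit Types (f g : ncpoly R) (w : {fmonom bool}).
Local Notation cst := (@malgC {fmonom bool} R : R -> ncpoly R).

Lemma nccstC (c : R) f : cst c * f = f * cst c.
Proof.
rewrite mul_malgC [RHS]malgM_def fgmulgU malgZ_def.
by apply: eq_bigr => w _; rewrite mulrC mulm1.
Qed.

Lemma malgUM (c d : R) w1 w2 :
  << c *g w1 >> * << d *g w2 >> = << c * d *g mmul w1 w2 >> :> ncpoly R.
Proof. by rewrite malgM_def fgmulUU. Qed.

Lemma ncTE f : ncT f = mmap (@malgC _ R) (fun w => << FMonom (rev w) >>) f.
Proof. by apply: eq_bigr => w _; rewrite malgUM mulr1 mul1m. Qed.

Fact ncT_additive : additive (@ncT R).
Proof. by move=> f g; rewrite !ncTE raddfB. Qed.

HB.instance Definition _ :=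
  GRing.isAdditive.Build (ncpoly R) (ncpoly R) (@ncT R) ncT_additive.

Lemma ncTU (c : R) w : ncT << c *g w >> = << c *g FMonom (rev w) >>.
Proof. by rewrite ncTE mmapU malgUM mulr1 mul1m. Qed.

Lemma ncTM f g : ncT (f * g) = ncT g * ncT f.
Proof.
rewrite malgME raddf_sum [ncT f]/ncT mulr_sumr; apply: eq_bigr => i _.
rewrite raddf_sum [ncT g]/ncT mulr_suml; apply: eq_bigr => j _.
rewrite /= ncTU malgUM mulrC; congr << _ *g _ >>.
by apply/eqP; rewrite fmP !fmM /= rev_cat.
Qed.

Lemma ncTC (c : R) : ncT (cst c) = cst c.
Proof. by rewrite ncTU; congr << _ *g _ >>; apply/eqP; rewrite fmP fm1. Qed.

Lemma ncTx : ncT (ncx R) = ncx R.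
Proof. by rewrite ncTU; congr << _ *g _ >>; apply/eqP; rewrite fmP fmU. Qed.

Lemma ncTh : ncT (nch R) = nch R.
Proof. by rewrite ncTU; congr << _ *g _ >>; apply/eqP; rewrite fmP fmU. Qed.

Lemma ncTXn f n : ncT (f ^+ n) = ncT f ^+ n.
Proof.
elim: n => [|n IH]; first by rewrite !expr0 ncTC.
by rewrite exprS exprSr ncTM IH.
Qed.

(** Any degree in [h] is allowed, so that degrees add up in products; [hdeg 1] is [hdeg1]. *)
Definition hdeg (n : nat) f := all (fun w => count_mem true w == n) (msupp f).

Lemma hdegP n f :
  reflect (forall w, f@_w != 0 -> count_mem true w = n) (hdeg n f).
Proof.
apply: (iffP allP) => [fn w|fn w]; first by rewrite mcoeff_neq0 => /fn/eqP.
by rewrite -mcoeff_neq0 => /fn->.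
Qed.

Lemma hdegD n f g : hdeg n f -> hdeg n g -> hdeg n (f + g).
Proof.
move=> /hdegP fn /hdegP gn; apply/hdegP => w; rewrite mcoeffD.
by have [->|/fn//] := eqVneq f@_w 0; rewrite add0r => /gn.
Qed.

Lemma hdeg0 n : hdeg n 0.
Proof. by apply/hdegP => w; rewrite mcoeff0 eqxx. Qed.

Lemma hdegU (c : R) w : hdeg (count_mem true w) << c *g w >>.
Proof.
by apply/hdegP => w'; rewrite mcoeffU; case: (w =P w') => [->//|_]; rewrite eqxx.
Qed.

Lemma hdegM m n f g : hdeg m f -> hdeg n g -> hdeg (m + n) (f * g).
Proof.
move=> /allP fm /allP gn; apply/allP => w /msuppM_le[w1 [w2 [/fm/eqP fw /gn/eqP gw ->]]].
by rewrite fmM count_cat fw gw.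
Qed.

Lemma hdeg_sum n (I : Type) (r : seq I) (P : pred I) (F : I -> ncpoly R) :
  (forall i, P i -> hdeg n (F i)) -> hdeg n (\sum_(i <- r | P i) F i).
Proof.
by move=> Fn; elim/big_ind: _ => //; [apply: hdeg0 | move=> *; apply: hdegD].
Qed.

Lemma hdeg0_cst c : hdeg 0 (cst c). Proof. by have := hdegU c mone; rewrite fm1. Qed.

Lemma hdeg0_x n : hdeg 0 (ncx R ^+ n).
Proof.
elim: n => [|n IH]; first exact: hdeg0_cst.
by rewrite exprS -[0%N]addn0; apply: hdegM => //; have := hdegU 1 (fmu false); rewrite fmU.
Qed.

Lemma hdeg1_h : hdeg 1 (nch R). Proof. by have := hdegU 1 (fmu true); rewrite fmU. Qed.

Local Notation ev := (horner_morph (cst_comm nccstC (ncx R))).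

Lemma ncT_ev (p : {poly R}) : ncT (ev p) = ev p.
Proof.
rewrite evE raddf_sum; apply: eq_bigr => i _.
by rewrite /= ncTM ncTXn ncTx ncTC nccstC.
Qed.

Lemma hdeg0_ev (p : {poly R}) : hdeg 0 (ev p).
Proof.
rewrite evE; apply: hdeg_sum => i _; rewrite -[0%N]addn0.
by apply: hdegM; [apply: hdeg0_cst | apply: hdeg0_x].
Qed.

Local Notation biact := (biact nccstC (ncx R) (nch R)).
Local Notation biactT := (biactT nccstC (ncx R) (nch R)).

Lemma ncT_biact P : ncT (biact P) = biactT P.
Proof.
rewrite biactE raddf_sum; apply: eq_bigr => j _.
by rewrite /= !ncTM ncTXn ncTx ncTh ncT_ev.
Qed.

Lemma ncT_biactT P : ncT (biactT P) = biact P.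
Proof.
rewrite biactE raddf_sum; apply: eq_bigr => j _.
by rewrite /= !ncTM ncTXn ncTx ncTh ncT_ev.
Qed.

Lemma hdeg1_biact P : hdeg1 (biact P).
Proof.
rewrite biactE; apply: hdeg_sum => j _; rewrite -[1%N]addn0.
apply: hdegM; last exact: hdeg0_x.
by rewrite -[1%N]add0n; apply: hdegM; [apply: hdeg0_ev | apply: hdeg1_h].
Qed.

Lemma hdeg1_biactT P : hdeg1 (biactT P).
Proof.
apply: hdeg_sum => j _; rewrite -[1%N]add0n; apply: hdegM; first exact: hdeg0_x.
by rewrite -[1%N]addn0; apply: hdegM; [apply: hdeg1_h | apply: hdeg0_ev].
Qed.

Lemma nchess_cyceq (W : seq {poly R}) (p : {poly R}) :
  {in W, forall w : {poly R}, (size w <= 2)%N} -> wsos W p^`(2) ->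
  exists s : seq ({poly R} * ncpoly R),
    [/\ all (fun c => c.1 \in W) s, all (@hdeg1 R) [seq c.2 | c <- s] &
    cyc_equiv (nchess p) (\sum_(c <- s) ncT c.2 * ev c.1 * c.2)].
Proof.
move=> sizeW Wp.
have [s [t [Wst hp]]] := hess_cyceq nccstC (ncx R) (nch R) sizeW Wp.
(* The involution exchanges [biact] and [biactT], so both kinds of terms are of the form
   [ncT f * ev w * f]. *)
exists ([seq (c.1, biact c.2) | c <- s] ++ [seq (c.1, biactT c.2) | c <- t]).
split.
- by move: Wst; rewrite !all_cat !all_map.
- rewrite map_cat -!map_comp all_cat !all_map; apply/andP.
  by split; apply/allP => c _; [apply: hdeg1_biact | apply: hdeg1_biactT].
rewrite big_cat !big_map /=.
under eq_bigr do rewrite ncT_biact.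
under [X in _ + X]eq_bigr do rewrite ncT_biactT.
exact: hp.
Qed.

Lemma nchess_cyceq2 (w1 w2 p : {poly R}) :
  (size w1 <= 2)%N -> (size w2 <= 2)%N -> wsos [:: w1; w2] p^`(2) ->
  exists q r : seq (ncpoly R), all (@hdeg1 R) (q ++ r) /\
    cyc_equiv (nchess p) (\sum_(f <- q) ncT f * ev w1 * f +
                          \sum_(f <- r) ncT f * ev w2 * f).
Proof.
move=> size1 size2 Wp.
have [|s [Ws hs]] := @nchess_cyceq [:: w1; w2] p _ Wp.
  by move=> w; rewrite !inE => /orP[] /eqP->.
exists [seq c.2 | c <- s & c.1 == w1], [seq c.2 | c <- s & c.1 != w1]; split.
  move: hs; rewrite all_cat !all_map => /allP hs.
  by apply/andP; split; apply/allP => c; rewrite mem_filter => /andP[_ /hs].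
rewrite -(@big_two_values _ _ _ (fun (w : {poly R}) f => ncT f * ev w * f)) //.
Qed.

Lemma size_CsubX (a : R) : size (a%:P - 'X)%R = 2%N.
Proof. by rewrite -opprB size_polyN size_XsubC. Qed.

Lemma nchess_itv (p : {poly R}) (a b : R) : a < b ->
  (forall x, a < x < b -> 0 <= p^`(2).[x]) ->
  exists r s : seq (ncpoly R), all (@hdeg1 R) (r ++ s) /\
    cyc_equiv (nchess p)
      (\sum_(f <- r) ncT f * (ncx R - nccst a) * f +
       \sum_(f <- s) ncT f * (nccst b - ncx R) * f).
Proof.
move=> ltab /(wsos_itv ltab)/nchess_cyceq2; rewrite size_XsubC size_CsubX.
by rewrite ev_XsubC ev_CsubX; apply.
Qed.

Lemma nchess_ray (w p : {poly R}) : (size w <= 2)%N -> wsos [:: 1; w] p^`(2) ->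
  exists q r : seq (ncpoly R), all (@hdeg1 R) (q ++ r) /\
    cyc_equiv (nchess p)
      (\sum_(f <- q) ncT f * f + \sum_(f <- r) ncT f * ev w * f).
Proof.
move=> size_w /nchess_cyceq2[||q [r [qr hp]]]; rewrite ?size_poly1 //.
exists q, r; split; first exact: qr.
by move: hp; under eq_bigr do rewrite ev_1 mulr1.
Qed.

Lemma nchess_right_ray (p : {poly R}) (b : R) :
  (forall x, b < x -> 0 <= p^`(2).[x]) ->
  exists q r : seq (ncpoly R), all (@hdeg1 R) (q ++ r) /\
    cyc_equiv (nchess p)
      (\sum_(f <- q) ncT f * f + \sum_(f <- r) ncT f * (ncx R - nccst b) * f).
Proof.
by move=> /wsos_right_ray/nchess_ray; rewrite size_XsubC ev_XsubC; apply.
Qed.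

Lemma nchess_left_ray (p : {poly R}) (a : R) :
  (forall x, x < a -> 0 <= p^`(2).[x]) ->
  exists q r : seq (ncpoly R), all (@hdeg1 R) (q ++ r) /\
    cyc_equiv (nchess p)
      (\sum_(f <- q) ncT f * f + \sum_(f <- r) ncT f * (nccst a - ncx R) * f).
Proof.
by move=> /wsos_left_ray/nchess_ray; rewrite size_CsubX ev_CsubX; apply.
Qed.

End FreeAlgebra.

(** Evaluation over a noncommutative ring respects these products because the point [t] is
    central. *)
Lemma horner_line_central (A : nzRingType) (P : {poly A}) (a b c t : A) :
  (forall u, t * u = u * t) ->
  (P * a%:P + P * b%:P * 'X + c%:P).[t] = P.[t] * a + P.[t] * b * t + c.
Proof.
move=> tC; have hMC (Q : {poly A}) u : (Q * u%:P).[t] = Q.[t] * u.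
  by rewrite hornerM_comm ?hornerC // /comm_poly hornerC tC.
by rewrite !hornerD hornerC hornerMX !hMC.
Qed.

(** * Evaluation at matrices *)

Section MatrixEvaluation.
Variables (R : realType) (n : nat).
Implicit Types (X H : 'M[R]_n.+1) (f g : ncpoly R) (w : {fmonom bool}).
Local Notation cst := (@malgC {fmonom bool} R : R -> ncpoly R).

Definition mxword X H w : 'M[R]_n.+1 :=
  \prod_(b <- (w : seq bool)) (if b then H else X).

Definition evmx X H f : 'M[R]_n.+1 := mmap (@scalar_mx R n.+1) (mxword X H) f.

Fact evmx_additive X H : additive (evmx X H).
Proof. by move=> f g; rewrite /evmx raddfB. Qed.

HB.instance Definition _ X H :=
  GRing.isAdditive.Build (ncpoly R) 'M[R]_n.+1 (evmx X H) (evmx_additive X H).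

Lemma evmxU X H (c : R) w : evmx X H << c *g w >> = c *: mxword X H w.
Proof. by rewrite /evmx mmapU -[RHS]mul_scalar_mx. Qed.

Lemma mxwordM X H w1 w2 : mxword X H (mmul w1 w2) = mxword X H w1 * mxword X H w2.
Proof. by rewrite /mxword fmM big_cat. Qed.

Lemma evmxM X H f g : evmx X H (f * g) = evmx X H f * evmx X H g.
Proof.
have sE c (A : 'M[R]_n.+1) : c%:M * A = c *: A := mul_scalar_mx c A.
rewrite malgME raddf_sum [evmx X H f]/evmx /mmap mulr_suml; apply: eq_bigr => i _.
rewrite raddf_sum [evmx X H g]/evmx /mmap mulr_sumr; apply: eq_bigr => j _.
by rewrite /= evmxU mxwordM !sE -scalerAl -scalerAr scalerA.
Qed.

Lemma evmxD X H f g : evmx X H (f + g) = evmx X H f + evmx X H g.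
Proof. exact: raddfD. Qed.

(* Stated with the values as parameters, and proved without rewriting, to keep
   unification from unfolding the product of the free algebra. *)
Lemma evmx_line X H f g u v k (F G U V M : 'M[R]_n.+1) :
  evmx X H f = F -> evmx X H g = G -> evmx X H u = U -> evmx X H v = V ->
  evmx X H k = M -> evmx X H (f * g + f * u * v + k) = F * G + F * U * V + M.
Proof.
move=> <- <- <- <- <-; apply: (etrans (evmxD _ _ _ _)); congr (_ + _).
apply: (etrans (evmxD _ _ _ _)); congr (_ + _); first exact: evmxM.
by apply: (etrans (evmxM _ _ _ _)); congr (_ * _); apply: evmxM.
Qed.

Lemma horner_mx_rec X (p : {poly R}) c :
  horner_mx X (p * 'X + c%:P) = horner_mx X p * X + c%:M.
Proof. by rewrite rmorphD rmorphM /= horner_mx_X horner_mx_C. Qed.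

Lemma evmx_cst X H c : evmx X H (cst c) = c%:M.
Proof. by rewrite evmxU /mxword fm1 big_nil scalemx1. Qed.

Lemma evmx_x X H : evmx X H (ncx R) = X.
Proof. by rewrite evmxU /mxword fmU big_seq1 scale1r. Qed.

Lemma evmx_h X H : evmx X H (nch R) = H.
Proof. by rewrite evmxU /mxword fmU big_seq1 scale1r. Qed.

Lemma evmx_ncT X H f : X^T = X -> H^T = H -> evmx X H (ncT f) = (evmx X H f)^T.
Proof.
move=> symX symH; rewrite [in RHS](monalgE f) [evmx X H (ncT f)]raddf_sum.
rewrite (raddf_sum (evmx X H)) [RHS]raddf_sum; apply: eq_bigr => w _.
rewrite /= !evmxU linearZ /=; congr (_ *: _); rewrite /mxword /=.
elim: (w : seq bool) => [|b s IH]; first by rewrite !big_nil trmx1.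
rewrite rev_cons -cats1 big_cat big_seq1 big_cons IH [RHS]trmx_mul.
by case: b; rewrite ?symX ?symH.
Qed.

Definition trev X H f : R := \tr (evmx X H f).

Fact trev_additive X H : additive (trev X H).
Proof. by move=> f g; rewrite /trev !raddfB. Qed.

HB.instance Definition _ X H :=
  GRing.isAdditive.Build (ncpoly R) R (trev X H) (trev_additive X H).

Lemma trev_mulC X H f g : trev X H (f * g) = trev X H (g * f).
Proof.
apply: (etrans (congr1 mxtrace (evmxM X H f g))).
apply: (etrans _ (esym (congr1 mxtrace (evmxM X H g f)))).
exact: mxtrace_mulC.
Qed.

(** Commutators of matrices have trace zero. *)
Lemma trev_cyceq X H f g : cyc_equiv f g -> trev X H f = trev X H g.
Proof.
move=> [s fg]; apply/eqP; rewrite -subr_eq0 -(raddfB (trev X H)) /= fg.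
rewrite (raddf_sum (trev X H)) big1 // => c _.
apply: (etrans (raddfB (trev X H) _ _)); apply/eqP; rewrite subr_eq0.
exact/eqP/trev_mulC.
Qed.

(** This is the real polynomial [t |-> Tr p(X + t H)]. Taking traces coefficientwise relates its
    second derivative directly to [nchess p]. *)
Definition trpath X H (p : {poly R}) : {poly R} := map_poly (trev X H) (ncshift p).

Lemma ncshift_rec (p : {poly R}) (c : R) :
  ncshift (p * 'X + c%:P) =
  ncshift p * (ncx R)%:P + ncshift p * (nch R)%:P * 'X + (cst c)%:P.
Proof. exact: (horner_line_rec (@nccstC R)). Qed.

Lemma evmx_horner_ncshift X H (p : {poly R}) t :
  evmx X H (ncshift p).[cst t] = horner_mx (X + t *: H) p.
Proof.
elim/poly_ind: p => [|p c IH].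
  by rewrite /ncshift map_poly0 !horner0 !raddf0.
rewrite ncshift_rec; move: (ncshift p) IH => P IH.
rewrite (horner_line_central P _ _ _ (nccstC t)).
rewrite (evmx_line IH (evmx_x X H) (evmx_h X H) (evmx_cst X H t) (evmx_cst X H c)).
rewrite horner_mx_rec mulrDr -mulrA.
by congr (_ + _ * _ + _); apply: mul_mx_scalar.
Qed.

Lemma trevM_cst X H f c : trev X H (f * cst c) = trev X H f * c.
Proof.
rewrite /trev evmxM evmx_cst mulrC -mxtraceZ; congr (\tr _).
exact: mul_mx_scalar.
Qed.

Lemma horner_map_trev X H (P : {poly ncpoly R}) t :
  (map_poly (trev X H) P).[t] = trev X H P.[cst t].
Proof.
rewrite (horner_coef P) (raddf_sum (trev X H)) /=.
rewrite (@horner_coef_wide _ (size P)) ?size_poly //; apply: eq_bigr => i _.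
by rewrite coef_map /= -(rmorphXn (@malgC {fmonom bool} R)) trevM_cst.
Qed.

Lemma horner_trpath X H (p : {poly R}) t :
  (trpath X H p).[t] = \tr (horner_mx (X + t *: H) p).
Proof. by rewrite -evmx_horner_ncshift; apply: horner_map_trev. Qed.

Lemma trpath_deriv2 X H (p : {poly R}) : (trpath X H p)^`(2).[0] = trev X H (nchess p).
Proof.
by rewrite /nchess !horner_coef0 !coef_derivn coef_map (raddfMn (trev X H)).
Qed.

Lemma poly_horner_inj (p q : {poly R}) : (forall t, p.[t] = q.[t]) -> p = q.
Proof.
move=> pq; apply/eqP; rewrite -subr_eq0; apply/eqP.
apply: (@roots_geq_poly_eq0 _ _ [seq i%:R | i <- iota 0 (size (p - q))]).
- by apply/allP => x _; rewrite /root hornerD hornerN pq subrr.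
- by rewrite map_inj_uniq ?iota_uniq // => i j /eqP; rewrite eqr_nat => /eqP.
- by rewrite size_map size_iota.
Qed.

(** Translating the parameter by [t] amounts to moving the base point to [X + t *: H], which reduces
    the claim to the derivative at 0. *)
Lemma trpath_deriv2_shift X H (p : {poly R}) t :
  (trpath X H p)^`(2).[t] = trev (X + t *: H) H (nchess p).
Proof.
rewrite -trpath_deriv2; have <- : trpath X H p \Po ('X + t%:P) = trpath (X + t *: H) H p.
  apply: poly_horner_inj => s; rewrite horner_comp !hornerE !horner_trpath.
  by rewrite scalerDl -addrA [t *: H + _]addrC.
rewrite !derivSn !derivn0 !deriv_comp derivD derivX derivC addr0 !mulr1.
by rewrite deriv_comp derivD derivX derivC addr0 mulr1 horner_comp !hornerE.
Qed.

End MatrixEvaluation.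

(** * Convexity of the trace *)

Section PositiveSemidefinite.
Variable R : realType.

Definition psdmx n (A : 'M[R]_n) : Prop :=
  A^T = A /\ forall v : 'cV[R]_n, 0 <= (v^T *m A *m v) 0 0.

Lemma symmetricmxE n (A : 'M[R]_n) : (A \is symmetricmx) = (A^T == A).
Proof. by rewrite is_hermitianmxE expr0 scale1r map_mx_id // eq_sym. Qed.

Lemma posdefmx_psd n (A : 'M[R]_n) : posdefmx A -> psdmx A.
Proof.
move=> [symA posA]; split; first by apply/eqP; rewrite -symmetricmxE.
move=> v; have [->|/posA/ltW//] := eqVneq v 0.
by rewrite mulmx0 mxE.
Qed.

Lemma psdmx_conv n (A B : 'M[R]_n) t : 0 <= t <= 1 -> psdmx A -> psdmx B ->
  psdmx (A + t *: (B - A)).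
Proof.
move=> /andP[t0 t1] [symA psdA] [symB psdB].
have -> : A + t *: (B - A) = (1 - t) *: A + t *: B.
  by rewrite scalerBl scale1r scalerBr addrA addrAC.
split; first by rewrite linearD !linearZ /= symA symB.
move=> v; have hA := psdA v; have hB := psdB v.
rewrite mulmxDr mulmxDl -!scalemxAr -!scalemxAl.
move: (v^T *m A *m v) (v^T *m B *m v) hA hB => a b hA hB; rewrite !mxE.
by rewrite addr_ge0 // mulr_ge0 ?subr_ge0.
Qed.

(** The diagonal entries are the values of the form [W] at the columns of [F]. *)
Lemma psdmx_trace_form n m (W : 'M[R]_n) (F : 'M[R]_(n, m)) :
  psdmx W -> 0 <= \tr (F^T *m W *m F).
Proof.
move=> [_ psdW]; apply: sumr_ge0 => j _.
have := psdW (col j F); rewrite tr_col -row_mul.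
suff -> : (row j (F^T *m W) *m col j F) 0 0 = (F^T *m W *m F) j j by [].
by rewrite [LHS]mxE [RHS]mxE; apply: eq_bigr => k _; rewrite !mxE.
Qed.

Lemma psdmx_gram n (A : 'M[R]_n) : psdmx A -> exists C : 'M_n, A = C^T *m C.
Proof.
move=> [symA psdA]; apply: psd_gram => // v.
by have := psdA v^T; rewrite trmxK.
Qed.

(** Writing [A] as [C^T *m C] and rotating [C^T] to the end turns the trace into that of [B]
    congruent by [F *m C^T]. *)
Lemma psdmx_trace_mul n (A B F : 'M[R]_n) :
  psdmx A -> psdmx B -> 0 <= \tr (A *m F^T *m B *m F).
Proof.
move=> /psdmx_gram[C ->] psdB; rewrite -!mulmxA mxtrace_mulC.
have := psdmx_trace_form (F *m C^T) psdB.
by rewrite trmx_mul trmxK !mulmxA.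
Qed.

(** With [B = c - A], which commutes with [A], one has [c A B = A B A + B A B]; both summands are
    congruences of semidefinite matrices. *)
Lemma psdmx_trace_complement n (A F : 'M[R]_n) (c : R) : 0 < c ->
  psdmx A -> psdmx (c%:M - A) -> 0 <= \tr (F^T *m (A *m (c%:M - A)) *m F).
Proof.
move=> c_gt0 psdA psdB; set B := c%:M - A.
rewrite -(pmulr_rge0 _ c_gt0) -mxtraceZ.
have symA := psdA.1; have symB := psdB.1.
have -> : c *: (F^T *m (A *m B) *m F) =
    (A *m F)^T *m B *m (A *m F) + (B *m F)^T *m A *m (B *m F).
  have BA : B *m A = A *m B.
    by rewrite mulmxBl mulmxBr mul_scalar_mx mul_mx_scalar.
  have -> : (A *m F)^T *m B *m (A *m F) = F^T *m (A *m B *m A) *m F.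
    by rewrite trmx_mul symA !mulmxA.
  have -> : (B *m F)^T *m A *m (B *m F) = F^T *m (A *m B *m B) *m F.
    by rewrite trmx_mul symB -BA !mulmxA.
  rewrite -mulmxDl -!mulmxDr [A + B]addrC subrK mul_mx_scalar.
  by rewrite -scalemxAr -scalemxAl.
by rewrite raddfD addr_ge0 //; apply: psdmx_trace_form.
Qed.

End PositiveSemidefinite.

Section TraceConvexity.
Variable R : realType.
Implicit Types (p : {poly R}) (f g : ncpoly R).

Lemma deriv2_ge0_poly_convex p (i : interval R) :
  {in i, forall x, 0 <= p^`(2).[x]} -> poly_convex_on p i.
Proof.
move=> p2; have iconv u v z : u \in i -> v \in i -> u < z < v -> z \in i.
  case: i {p2} => l r; rewrite !itv_boundlr => /andP[lu _] /andP[_ vr] /andP[uz zv].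
  by rewrite (le_trans lu) ?(le_trans _ vr) ?bnd_simp ?ltW.
have conv u v l : u \in i -> v \in i -> u < v -> 0 <= l <= 1 ->
    p.[l * u + (1 - l) * v] <= l * p.[u] + (1 - l) * p.[v].
  move=> ui vi uv l01; apply: deriv2_ge0_convex => // z uzv; apply: p2.
  exact: iconv uzv.
have main u v l : u \in i -> v \in i -> 0 <= l <= 1 ->
    p.[l * u + (1 - l) * v] <= l * p.[u] + (1 - l) * p.[v].
  (* If [v < u], the two points are exchanged and [l] is replaced by [1 - l]. *)
  move=> ui vi l01; have [uv|vu|->] := ltgtP u v; first exact: conv.
    have := conv v u (1 - l) vi ui vu.
    rewrite subKr [_ + l * u]addrC [_ + l * p.[u]]addrC; apply.
    by rewrite subr_ge0 lerBlDr lerDl andbC.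
  by rewrite -!mulrDl addrC subrK !mul1r.
move=> t x y; rewrite !mem_setE => xi yi.
by apply: main => //; rewrite ge0 le1.
Qed.

Lemma poly_convex_deriv2_ge0 p (i : interval R) (c d : R) : 0 < d ->
  (forall t, 0 < t <= d -> (c + t \in i) && (c - t \in i)) ->
  poly_convex_on p i -> 0 <= p^`(2).[c].
Proof.
move=> d_gt0 cd p_conv; apply: (midconvex_deriv2_ge0 d_gt0) => t /cd/andP[ci ci'].
have h0 : 0 <= 2^-1 :> R by rewrite invr_ge0.
have h1 : 2^-1 <= 1 :> R by lra.
have : p.[2^-1 * (c + t) + (1 - 2^-1) * (c - t)] <=
       2^-1 * p.[c + t] + (1 - 2^-1) * p.[c - t].
  by apply: (p_conv (Itv01 h0 h1)); rewrite mem_setE.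
have -> : 2^-1 * (c + t) + (1 - 2^-1) * (c - t) = c by lra.
by lra.
Qed.

Lemma horner_mx1 p (x : R) : \tr (horner_mx (x%:M : 'M[R]_1) p) = p.[x].
Proof.
suff -> : horner_mx (x%:M : 'M[R]_1) p = p.[x]%:M by rewrite mxtrace_scalar mulr1n.
elim/poly_ind: p => [|p c IH]; first by rewrite raddf0 horner0 raddf0.
by rewrite horner_mx_rec IH hornerMXaddC raddfD /= scalar_mxM.
Qed.

(** The index 0 stands for size 1, where trace convexity is midpoint convexity of [p]. *)
Lemma tr_convex_deriv2_ge0 p (D : forall n, 'M[R]_n.+1 -> Prop) (c d : R) :
  0 < d -> (forall t, 0 < t <= d -> D 0%N (c + t)%:M /\ D 0%N (c - t)%:M) ->
  tr_convex_on p D -> 0 <= p^`(2).[c].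
Proof.
move=> d_gt0 cd p_conv; apply: (midconvex_deriv2_ge0 d_gt0) => t /cd[Dp Dm].
have := p_conv 0%N _ _ _ _ Dp Dm; rewrite !symmetricmxE !tr_scalar_mx !eqxx.
move=> /(_ isT isT).
have -> : 2^-1 *: ((c + t)%:M + (c - t)%:M) = c%:M :> 'M[R]_1.
  by rewrite -(raddfD (@scalar_mx R 1)) /= scale_scalar_mx; congr _%:M; lra.
by rewrite !horner_mx1; lra.
Qed.

Lemma mxprec_scalar n (x y : R) : x < y -> mxprec (x%:M : 'M_n) y%:M.
Proof.
move=> ltxy; rewrite /mxprec -raddfB /=; split.
  by rewrite symmetricmxE tr_scalar_mx.
move=> v v_neq0; rewrite mul_mx_scalar -scalemxAl mxE.
rewrite mulr_gt0 ?subr_gt0 // mxE lt_neqAle; apply/andP; split.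
  apply: contra v_neq0; rewrite eq_sym psumr_eq0 => [/allP v0|i _]; last first.
    by rewrite mxE -expr2 sqr_ge0.
  apply/eqP/colP => i; have := v0 i (mem_index_enum _).
  by rewrite !mxE -expr2 sqrf_eq0 => /eqP.
by apply: sumr_ge0 => i _; rewrite mxE -expr2 sqr_ge0.
Qed.

(** Along the segment from [X] to [Y], the second derivative of the trace at time [t] is the trace
    of [g] at [X + t *: H]. The condition [P] is what the strict domain [D] leaves on the
    segment. *)
Lemma tr_convex_of_form p g (D P : forall n, 'M[R]_n.+1 -> Prop) :
  (forall n (X Y : 'M[R]_n.+1) t, D n X -> D n Y -> 0 <= t <= 1 ->
     P n (X + t *: (Y - X))) ->
  (forall n (X H : 'M[R]_n.+1), X^T = X -> H^T = H -> P n X -> 0 <= trev X H g) ->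
  cyc_equiv (nchess p) g -> tr_convex_on p D.
Proof.
move=> DP Pg pg n X Y; rewrite !symmetricmxE => /eqP symX /eqP symY DX DY.
pose H := Y - X; have symH : H^T = H by rewrite raddfB /= symX symY.
have := @deriv2_ge0_convex _ (trpath X H p) 0 1 2^-1.
rewrite !horner_trpath scale0r addr0 scale1r [X + H]addrC subrK mulr0 add0r mulr1.
have -> : X + (1 - 2^-1) *: H = 2^-1 *: (X + Y).
  have -> : 1 - 2^-1 = 2^-1 :> R by lra.
  rewrite scalerBr addrCA -[X in _ + (X - _)]scale1r -scalerBl scalerDr addrC.
  by congr (_ *: _ + _); lra.
have -> : 1 - 2^-1 = 2^-1 :> R by lra.
rewrite -mulrDr; apply => //; last by apply/andP; split; lra.
move=> t /andP[t0 t1]; rewrite trpath_deriv2_shift (trev_cyceq _ _ pg).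
apply: Pg => //; last by apply: DP => //; rewrite !ltW.
by rewrite [LHS]raddfD /= [(t *: H)^T]linearZ /= symX symH.
Qed.

Variables (n : nat) (X H : 'M[R]_n.+1).
Hypotheses (symX : X^T = X) (symH : H^T = H).

Lemma trev_sum_ge0 (s : seq (ncpoly R)) (F : ncpoly R -> ncpoly R) :
  (forall f, 0 <= trev X H (F f)) -> 0 <= trev X H (\sum_(f <- s) F f).
Proof. by move=> F_ge0; rewrite (raddf_sum (trev X H)); apply: sumr_ge0 => f _; apply: F_ge0. Qed.

Lemma trevD_ge0 f g : 0 <= trev X H f -> 0 <= trev X H g -> 0 <= trev X H (f + g).
Proof. by move=> hf hg; rewrite (raddfD (trev X H)) addr_ge0. Qed.

Lemma trev_form f g (W : 'M[R]_n.+1) : evmx X H g = W ->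
  trev X H (ncT f * g * f) = \tr ((evmx X H f)^T *m W *m evmx X H f).
Proof.
move=> <-; apply: (congr1 mxtrace); apply: (etrans (evmxM _ _ _ _)).
congr (_ *m _); apply: (etrans (evmxM _ _ _ _)); congr (_ *m _).
exact: evmx_ncT.
Qed.

Lemma evmx_XsubC a : evmx X H (ncx R - nccst a) = X - a%:M.
Proof. by rewrite raddfB /= evmx_x evmx_cst. Qed.

Lemma evmx_CsubX a : evmx X H (nccst a - ncx R) = a%:M - X.
Proof. by rewrite raddfB /= evmx_x evmx_cst. Qed.

Lemma trev_sqr_ge0 f : 0 <= trev X H (ncT f * f).
Proof.
rewrite -[ncT f]mulr1 (@trev_form _ _ 1%:M) ?evmx_cst //.
apply: psdmx_trace_form; split; first exact: tr_scalar_mx.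
move=> v; rewrite mulmx1 mxE sumr_ge0 // => i _.
by rewrite mxE -expr2 sqr_ge0.
Qed.

Lemma trev_XsubC_ge0 f a : psdmx (X - a%:M) ->
  0 <= trev X H (ncT f * (ncx R - nccst a) * f).
Proof. by rewrite (trev_form _ (evmx_XsubC a)); apply: psdmx_trace_form. Qed.

Lemma trev_CsubX_ge0 f a : psdmx (a%:M - X) ->
  0 <= trev X H (ncT f * (nccst a - ncx R) * f).
Proof. by rewrite (trev_form _ (evmx_CsubX a)); apply: psdmx_trace_form. Qed.

Lemma trev_prod_ge0 f a b : a < b -> psdmx (X - a%:M) -> psdmx (b%:M - X) ->
  0 <= trev X H (ncT f * (ncx R - nccst a) * (nccst b - ncx R) * f).
Proof.
move=> ltab psdA psdB; rewrite -[_ * _ * (nccst b - _)]mulrA.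
have -> := @trev_form f _ ((X - a%:M) *m (b%:M - X)).
  (* This puts the second weight in complementary form, with constant [b - a]. *)
  have defB : b%:M - X = (b - a)%:M - (X - a%:M).
    by rewrite raddfB /= opprB addrA subrK.
  by rewrite defB; apply: psdmx_trace_complement; rewrite ?subr_gt0 // -defB.
apply: (etrans (evmxM _ _ _ _)); congr (_ *m _).
  exact: evmx_XsubC.
exact: evmx_CsubX.
Qed.

Lemma trev_mixed_ge0 f a b : psdmx (X - a%:M) -> psdmx (b%:M - X) ->
  0 <= trev X H ((ncx R - nccst a) * ncT f * (nccst b - ncx R) * f).
Proof.
move=> psdA psdB; have := psdmx_trace_mul (evmx X H f) psdA psdB.
suff -> : (X - a%:M) *m (evmx X H f)^T *m (b%:M - X) *m evmx X H f =
  evmx X H ((ncx R - nccst a) * ncT f * (nccst b - ncx R) * f) by [].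
apply/esym; apply: (etrans (evmxM _ _ _ _)); congr (_ *m _).
apply: (etrans (evmxM _ _ _ _)); congr (_ *m _); last exact: evmx_CsubX.
apply: (etrans (evmxM _ _ _ _)); congr (_ *m _); first exact: evmx_XsubC.
exact: evmx_ncT.
Qed.

End TraceConvexity.

(** * Segments in the matrix domains and the three equivalences *)

Lemma itv_symmetric_nbhs (R : realType) (a b c : R) : a < c < b ->
  exists2 d, 0 < d & forall t, 0 < t <= d -> a < c - t /\ c + t < b.
Proof.
(* Half the distance to the nearer endpoint keeps the inequalities strict even at [t = d]. *)
move=> /andP[ac cb]; exists (Num.min (c - a) (b - c) / 2).
  by rewrite divr_gt0 // lt_min !subr_gt0 ac.
move=> t /andP[t0 td]; have : t < Num.min (c - a) (b - c).
  apply: le_lt_trans td _; rewrite ltr_pdivrMr // ltr_pMr ?ltr1n //.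
  by rewrite lt_min !subr_gt0 ac.
by rewrite lt_min => /andP[]; split; lra.
Qed.

Lemma psdmx_line_sub (R : realType) n (A X Y : 'M[R]_n) t : 0 <= t <= 1 ->
  psdmx (X - A) -> psdmx (Y - A) -> psdmx (X + t *: (Y - X) - A).
Proof.
move=> t01 psdX psdY; rewrite addrAC.
have -> : Y - X = (Y - A) - (X - A) by rewrite opprB addrA subrK.
exact: psdmx_conv.
Qed.

Lemma psdmx_sub_line (R : realType) n (A X Y : 'M[R]_n) t : 0 <= t <= 1 ->
  psdmx (A - X) -> psdmx (A - Y) -> psdmx (A - (X + t *: (Y - X))).
Proof.
move=> t01 psdX psdY; rewrite opprD addrA -scalerN opprB.
have -> : X - Y = (A - Y) - (A - X) by rewrite opprB [RHS]addrC addrA subrK.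
exact: psdmx_conv.
Qed.

Theorem theorem3p2 (R : realType) (p : {poly R}) (a b : R) (ltab : a < b) :
  [/\ [<-> tr_convex_on p (fun n X => mxprec a%:M X /\ mxprec X b%:M);
           poly_convex_on p `]a, b[;
           exists q r s t u : seq (ncpoly R),
             all (@hdeg1 R) (q ++ r ++ s ++ t ++ u) /\
             cyc_equiv (nchess p)
               (\sum_(f <- q) ncT f * f
                + \sum_(f <- r) ncT f * (ncx R - nccst a) * f
                + \sum_(f <- s) ncT f * (nccst b - ncx R) * f
                + \sum_(f <- t)
                    ncT f * (ncx R - nccst a) * (nccst b - ncx R) * f
                + \sum_(f <- u)
                    (ncx R - nccst a) * ncT f * (nccst b - ncx R) * f)],
      [<-> tr_convex_on p (fun n X => mxprec b%:M X);
           poly_convex_on p `]b, +oo[;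
           exists q r : seq (ncpoly R),
             all (@hdeg1 R) (q ++ r) /\
             cyc_equiv (nchess p)
               (\sum_(f <- q) ncT f * f
                + \sum_(f <- r) ncT f * (ncx R - nccst b) * f)]
    & [<-> tr_convex_on p (fun n X => mxprec X a%:M);
           poly_convex_on p `]-oo, a[;
           exists q r : seq (ncpoly R),
             all (@hdeg1 R) (q ++ r) /\
             cyc_equiv (nchess p)
               (\sum_(f <- q) ncT f * f
                + \sum_(f <- r) ncT f * (nccst a - ncx R) * f)]].
Proof.
split; tfae.
(* Each equivalence is proved as a cycle. Trace convexity yields convexity of [p] through the sign
   of its second derivative at every point. *)
- move=> trp; apply: deriv2_ge0_poly_convex => c; rewrite in_itv /= => acb.
  have [d d_gt0 cd] := itv_symmetric_nbhs acb; have /andP[ac cb] := acb.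
  apply: (tr_convex_deriv2_ge0 d_gt0 _ trp) => t t_d.
  have [act ctb] := cd t t_d; have /andP[t_gt0 _] := t_d.
  by split; split; apply: mxprec_scalar => //; lra.
- move=> p_conv.
  have [|r [s [rs hp]]] := @nchess_itv R p a b ltab.
    move=> c acb; have [d d_gt0 cd] := itv_symmetric_nbhs acb.
    have /andP[ac cb] := acb.
    apply: (poly_convex_deriv2_ge0 d_gt0 _ p_conv) => t t_d.
    have [act ctb] := cd t t_d; have /andP[t_gt0 _] := t_d.
    by rewrite !in_itv /= act ctb andbT; lra.
  (* The weights [x - a] and [b - x] suffice, so the other three lists are empty. *)
  exists [::], r, s, [::], [::]; split; first by rewrite /= cats0.
  have e (V : nmodType) (T : Type) (F G H : T -> V) (x y : V) :
      \sum_(f <- [::]) F f + x + y + \sum_(f <- [::]) G f + \sum_(f <- [::]) H f =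
      x + y by rewrite !big_nil add0r !addr0.
  exact: (eq_ind_r (cyc_equiv (nchess p)) hp (e _ _ _ _ _ _ _)).
- move=> [q [r [s [t [u [_ hp]]]]]].
  (* Semidefiniteness of [X - a] and [b - X] passes to the whole segment and makes the five kinds of
     terms nonnegative in trace. *)
  apply: (tr_convex_of_form
    (P := fun n X => psdmx (X - a%:M) /\ psdmx (b%:M - X)) _ _ hp).
    move=> n X Y e [/posdefmx_psd aX /posdefmx_psd Xb] [/posdefmx_psd aY /posdefmx_psd Yb] e01.
    by split; [apply: psdmx_line_sub | apply: psdmx_sub_line].
  move=> n X H symX symH [psdA psdB]; do 4?[apply: trevD_ge0]; apply: trev_sum_ge0 => f.
  + exact: trev_sqr_ge0.
  + exact: trev_XsubC_ge0.
  + exact: trev_CsubX_ge0.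
  + exact: trev_prod_ge0.
  + exact: trev_mixed_ge0.
- move=> trp; apply: deriv2_ge0_poly_convex => c; rewrite in_itv /= andbT => bc.
  (* Half the distance to the endpoint keeps both test points inside the ray. *)
  have d_gt0 : 0 < (c - b) / 2 by rewrite divr_gt0 ?subr_gt0.
  apply: (tr_convex_deriv2_ge0 d_gt0 _ trp) => t /andP[t0 td].
  by split; apply: mxprec_scalar; lra.
- move=> p_conv; apply: nchess_right_ray => c bc.
  have d_gt0 : 0 < (c - b) / 2 by rewrite divr_gt0 ?subr_gt0.
  apply: (poly_convex_deriv2_ge0 d_gt0 _ p_conv) => t /andP[t0 td].
  by rewrite !in_itv /= !andbT; apply/andP; split; lra.
- move=> [q [r [_ hp]]].
  apply: (tr_convex_of_form (P := fun n X => psdmx (X - b%:M)) _ _ hp).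
    by move=> n X Y e /posdefmx_psd bX /posdefmx_psd bY e01; apply: psdmx_line_sub.
  move=> n X H symX symH psdB; apply: trevD_ge0; apply: trev_sum_ge0 => f.
  + exact: trev_sqr_ge0.
  + exact: trev_XsubC_ge0.
- move=> trp; apply: deriv2_ge0_poly_convex => c; rewrite in_itv /= => ca.
  have d_gt0 : 0 < (a - c) / 2 by rewrite divr_gt0 ?subr_gt0.
  apply: (tr_convex_deriv2_ge0 d_gt0 _ trp) => t /andP[t0 td].
  by split; apply: mxprec_scalar; lra.
- move=> p_conv; apply: nchess_left_ray => c ca.
  have d_gt0 : 0 < (a - c) / 2 by rewrite divr_gt0 ?subr_gt0.
  apply: (poly_convex_deriv2_ge0 d_gt0 _ p_conv) => t /andP[t0 td].
  by rewrite !in_itv /=; apply/andP; split; lra.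
- move=> [q [r [_ hp]]].
  apply: (tr_convex_of_form (P := fun n X => psdmx (a%:M - X)) _ _ hp).
    by move=> n X Y e /posdefmx_psd bX /posdefmx_psd bY e01; apply: psdmx_sub_line.
  move=> n X H symX symH psdA; apply: trevD_ge0; apply: trev_sum_ge0 => f.
  + exact: trev_sqr_ge0.
  + exact: trev_CsubX_ge0.
Qed.
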